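(* For all constants $a>0$ and $d>0$ there exist constants $b,c,K>0$ such that the following holds. Let $n,k$ be positive integers with $2k\le n$, and let $x\in\mathbb{R}^n$ have its coordinates ordered so that $|x_1|\ge|x_2|\ge\cdots\ge|x_n|$ and satisfy \[ |x_k|-|x_{2k}|\ge a\,\frac{\|x_{\overline{[k]}}\|_2}{\sqrt{k}}. \] Let $\widehat{x}$ be the Count-Sketch estimate of $x$ using $R\ge b\log n$ rows and $ck$ columns with fully random hash functions. Then with probability at least $1-K/k^d$, \[ E_k(x,\widehat{x})^2\le \frac{1}{R}\|x_{\overline{[k]}}\|_2^2 . \]
   Context: Count-Sketch with $R$ rows and $C$ columns: for each row $u\in[R]$ choose hash functions $h_u:[n]\to[C]$ and $s_u:[n]\to\{\pm1\}$; ''fully random'' means all values $h_u(i)$ (uniform on $[C]$) and $s_u(i)$ (uniform on $\{\pm1\}$) are mutually independent. The sketch is $y_{u,v}=\sum_{i:h_u(i)=v}s_u(i)x_i$ and the estimate is $\widehat{x}_i=\operatorname{median}_{u\in[R]} s_u(i)\,y_{u,h_u(i)}$ (average of the two middle values for even $R$). $x_{\overline{[k]}}$ denotes $x$ with its $k$ largest-magnitude coordinates (here $x_1,\dots,x_k$) replaced by $0$. For $z\in\mathbb{R}^n$, $H_k(z)$ is the restriction of $z$ to its $k$ largest-magnitude components (other coordinates set to $0$). The top-$k$ estimation error is $E_k(x,\widehat{x})=\min_{x'\in\mathbb{R}^n:\,H_k(x')=H_k(\widehat{x})}\|x-x'\|_2$. *)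

(* Defs.v *)
From HB Require Import structures.
From mathcomp Require Import all_boot all_order all_algebra.
From mathcomp Require Import all_classical all_reals all_analysis.
Set Implicit Arguments. Unset Strict Implicit. Unset Printing Implicit Defensive.
Import Order.TTheory GRing.Theory Num.Theory.
Local Open Scope ring_scope.
Local Open Scope classical_set_scope.

Section CountSketch.
Variable R : realType.

Definition vat (n : nat) (x : 'I_n -> R) (j : nat) : R :=
  match (insub j : option 'I_n) with Some i => x i | None => 0 end.

Definition norm2 (n : nat) (x : 'I_n -> R) : R := Num.sqrt (\sum_(i < n) x i ^+ 2).

Definition tail_norm (n k : nat) (x : 'I_n -> R) : R :=
  Num.sqrt (\sum_(i < n | (k <= i)%N) x i ^+ 2).

Definition median (s : seq R) : R :=
  let t := sort <=%R s in
  let m := size t in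
  if odd m then nth 0 t m./2
  else (nth 0 t m./2.-1 + nth 0 t m./2) / 2.

Definition sgn (b : bool) : R := if b then 1 else -1.

Definition cs_sketch (n rows C : nat)
  (h : {ffun 'I_rows -> {ffun 'I_n -> 'I_C}})
  (s : {ffun 'I_rows -> {ffun 'I_n -> bool}}) (x : 'I_n -> R)
  (u : 'I_rows) (v : 'I_C) : R :=
  \sum_(i < n | h u i == v) sgn (s u i) * x i.

Definition cs_estimate (n rows C : nat)
  (h : {ffun 'I_rows -> {ffun 'I_n -> 'I_C}})
  (s : {ffun 'I_rows -> {ffun 'I_n -> bool}}) (x : 'I_n -> R) : 'I_n -> R :=
  fun i => median [seq sgn (s u i) * cs_sketch h s x u (h u i) | u <- enum 'I_rows].

Definition mag_before (n : nat) (z : 'I_n -> R) (j i : 'I_n) : bool :=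
  (`|z i| < `|z j|) || ((`|z i| == `|z j|) && (j < i)%N).

Definition topk_set (n k : nat) (z : 'I_n -> R) : {set 'I_n} :=
  finset (fun i => #|finset (fun j => mag_before z j i)| < k)%N.

Definition Hk (n k : nat) (z : 'I_n -> R) : 'I_n -> R :=
  fun i => if i \in topk_set k z then z i else 0.

Definition Ek (n k : nat) (x xhat : 'I_n -> R) : R :=
  inf [set norm2 (fun i => x i - x' i) |
       x' in [set x' : 'I_n -> R | forall i, Hk k x' i = Hk k xhat i]].

Definition cs_prob (n rows C : nat)
  (E : {ffun 'I_rows -> {ffun 'I_n -> 'I_C}} ->
       {ffun 'I_rows -> {ffun 'I_n -> bool}} -> bool) : R :=
  (#|finset (fun hs : {ffun 'I_rows -> {ffun 'I_n -> 'I_C}} *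
               {ffun 'I_rows -> {ffun 'I_n -> bool}} => E hs.1 hs.2)|%:R /
   #|{: {ffun 'I_rows -> {ffun 'I_n -> 'I_C}} *
        {ffun 'I_rows -> {ffun 'I_n -> bool}}}|%:R).

End CountSketch.

(* Main.v *)
Require Import Defs.
From HB Require Import structures.
From mathcomp Require Import all_boot all_order all_algebra.
From mathcomp Require Import all_classical all_reals all_analysis.
From mathcomp Require Import ring lra zify.
Set Implicit Arguments. Unset Strict Implicit. Unset Printing Implicit Defensive.
Import Order.TTheory GRing.Theory Num.Theory.
Local Open Scope ring_scope.

(** Write the hash of i as a pair of buckets th_i together with the parity of two
    bits (p_i, q_i), q_i being the sign. Given th, the error of coordinate i in one
    row is then Y - Y' for two independent copies Y, Y' of a Bernoulli sum whose
    variance is O(V), V = ||tail||^2 / (number of pairs), unless a heavy coordinate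
    or too much tail mass falls into the pair. Chebyshev and Cauchy-Schwarz give
    P(|Y - Y'| <= rho sqrt V) >= rho / 20, so that an exponential moment over the
    independent rows shows that the median errs by more than rho sqrt V with
    probability exp(- Omega(rho^2 rows)).

    Given th, the errors of m coordinates in distinct pairs are independent; as
    m = O(log k) coordinates rarely share a pair, the joint exponential moment still
    factorizes up to a negligible error, and m given coordinates all err by more than
    rho sqrt V with probability exp(- Omega(m rho^2 rows)). Counting injective
    m-tuples of such coordinates, at the scales rho^2 = w / (m rows) with w of order
    log k and m = 1, ..., w / t1, bounds for all scales at once the number of
    coordinates below 2k with a large error, hence the sum of their squared errors.

    Finally, the gap hypothesis and a uniform bound sqrt V on the errors confine the
    top k estimates to the first 2k coordinates, so that this sum bounds E_k^2. *)

(** * Uniform averages and independence *)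

Section Average.
Variable R : realType.

Definition avg (T : finType) (f : T -> R) : R := (\sum_t f t) / #|T|%:R.

Lemma eq_avg (T : finType) (f g : T -> R) : f =1 g -> avg f = avg g.
Proof. by move=> fg; rewrite /avg (eq_bigr g). Qed.

Lemma le_avg (T : finType) (f g : T -> R) :
  (forall t, f t <= g t) -> avg f <= avg g.
Proof.
by move=> fg; rewrite /avg ler_wpM2r ?invr_ge0 ?ler0n// ler_sum.
Qed.

Lemma avg_ge0 (T : finType) (f : T -> R) : (forall t, 0 <= f t) -> 0 <= avg f.
Proof. by move=> f0; rewrite /avg divr_ge0 ?sumr_ge0. Qed.

Lemma avgD (T : finType) (f g : T -> R) :
  avg (fun t => f t + g t) = avg f + avg g.
Proof. by rewrite /avg big_split mulrDl. Qed.

Lemma avgZ (T : finType) (c : R) (f : T -> R) :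
  avg (fun t => c * f t) = c * avg f.
Proof. by rewrite /avg -mulr_sumr mulrA. Qed.

Lemma avgN (T : finType) (f : T -> R) : avg (fun t => - f t) = - avg f.
Proof. by rewrite /avg sumrN mulNr. Qed.

Lemma avg_cst (T : finType) (t0 : T) (c : R) : avg (fun _ : T => c) = c.
Proof.
have T0 : #|T|%:R != 0 :> R by rewrite pnatr_eq0 -lt0n; apply/card_gt0P; exists t0.
by rewrite /avg sumr_const -[c *+ _]mulr_natr mulfK.
Qed.

Lemma avg_sum (T : finType) (I : Type) (r : seq I) (P : pred I) (F : I -> T -> R) :
  avg (fun t => \sum_(i <- r | P i) F i t) = \sum_(i <- r | P i) avg (F i).
Proof. by rewrite /avg exchange_big /= mulr_suml. Qed.

Lemma avg_bij (T1 T2 : finType) (h : T1 -> T2) (f : T2 -> R) :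
  bijective h -> avg f = avg (fun t => f (h t)).
Proof.
move=> hb; rewrite /avg (bij_eq_card hb) (reindex h) //.
by case: hb => h' K K'; exists h' => t _.
Qed.

Lemma avg_pair (T1 T2 : finType) (f : T1 * T2 -> R) :
  avg f = avg (fun a => avg (fun b => f (a, b))).
Proof.
rewrite /avg -mulr_suml card_prod natrM invfM mulrA pair_bigA /= mulrAC.
by congr (_ / _ / _); apply: eq_bigr => -[].
Qed.

Lemma avg_ffun_prod (I T : finType) (F : I -> T -> R) :
  avg (fun w : {ffun I -> T} => \prod_i F i (w i)) = \prod_i avg (F i).
Proof.
rewrite /avg -bigA_distr_bigA card_ffun natrX big_split /= prodr_const.
by rewrite exprVn.
Qed.

Definition mix (I T : finType) (S : {set I}) (w w' : {ffun I -> T}) :=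
  [ffun i => if i \in S then w i else w' i].

Definition depends_on (I T : finType) (S : {set I}) (f : {ffun I -> T} -> R) :=
  forall w w' : {ffun I -> T}, {in S, w =1 w'} -> f w = f w'.

(* Swapping the S-coordinates of two independent copies is an involution. *)
Lemma avg_indep (I T : finType) (S : {set I}) (f g : {ffun I -> T} -> R) :
  depends_on S f -> depends_on (~: S) g ->
  avg (fun w => f w * g w) = avg f * avg g.
Proof.
move=> fS gS.
pose sw (p : {ffun I -> T} * {ffun I -> T}) := (mix S p.1 p.2, mix S p.2 p.1).
have swK : involutive sw.
  by case=> a b; congr (_, _); apply/ffunP => i; rewrite !ffunE /=; case: ifP => // ->.
have -> : avg f * avg g = avg (fun p : {ffun I -> T} * {ffun I -> T} => f p.1 * g p.2).
  rewrite avg_pair mulrC -avgZ; apply: eq_avg => a /=; rewrite avgZ mulrC //.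
transitivity (avg (fun p : {ffun I -> T} * {ffun I -> T} => f p.1 * g p.1)).
  rewrite avg_pair /=; case: (pickP (fun _ : {ffun I -> T} => true)) => [w0 _|no].
    by apply: eq_avg => a; rewrite (avg_cst w0).
  by rewrite /avg !big1 // => w; have := no w.
rewrite (avg_bij _ (inv_bij swK)); apply: eq_avg => -[a b] /=; congr (_ * _).
  by apply: fS => i iS; rewrite ffunE iS.
by apply: gS => i; rewrite inE ffunE => /negbTE ->.
Qed.

Lemma avg_prod_indep (I T : finType) (t0 : T) (m : nat) (B : 'I_m -> {set I})
    (F : 'I_m -> {ffun I -> T} -> R) :
  (forall r r', r != r' -> [disjoint B r & B r']) ->
  (forall r, depends_on (B r) (F r)) ->
  avg (fun w => \prod_r F r w) = \prod_r avg (F r).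
Proof.
move=> disB FB.
suff H s : uniq s ->
    avg (fun w => \prod_(r <- s) F r w) = \prod_(r <- s) avg (F r).
  by rewrite -(H _ (index_enum_uniq _)).
elim: s => [_|r s IH /= /andP[rs us]].
  by rewrite big_nil -[RHS](avg_cst [ffun _ : I => t0] 1); apply: eq_avg => w; rewrite big_nil.
rewrite big_cons -IH // -(avg_indep (S := B r)) //.
  by apply: eq_avg => w; rewrite big_cons.
move=> w w' ww'; apply: eq_big_seq => r' r's; apply: FB => i iB.
apply: ww'; rewrite inE; apply: contraTN iB => iB.
have rr' : r != r' by apply: contraNneq rs => ->.
by have /pred0P/(_ i) /= := disB _ _ rr'; rewrite iB /= => ->.
Qed.

End Average.

(** * Anticoncentration of one error term *)

Section AntiConcentration.
Variable R : realType.

(** From (1 - y) e^y <= 1 and (1 - y)(1 + y + 2 y^2) = 1 + y^2 (1 - 2 y) >= 1. *)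
Lemma expR_le_quad (y : R) : y <= 2^-1 -> expR y <= 1 + y + 2 * y ^+ 2.
Proof.
move=> y2; have y1 : 0 < 1 - y by lra.
have : (1 - y) * expR y <= 1.
  rewrite -[leRHS](expRxMexpNx_1 y) mulrC ler_wpM2l ?expR_ge0//.
  exact: expR_ge1Dx.
rewrite mulrC -ler_pdivlMr // => /le_trans; apply.
rewrite ler_pdivrMr //.
have : 0 <= y ^+ 2 * (1 - 2 * y) by rewrite mulr_ge0 ?sqr_ge0 //; lra.
by lra.
Qed.

(** For y > 1/2 the factor 4 y^2 exceeds 1, so the last term alone dominates. *)
Lemma expR_le_quad_abs (y : R) : expR y <= 1 + y + 4 * y ^+ 2 * expR `|y|.
Proof.
have y20 := sqr_ge0 y.
have e1 : 1 <= expR `|y| by rewrite -expR0 ler_expR.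
have [y2|y2] := leP y 2^-1.
  by apply: le_trans (expR_le_quad y2) _; nra.
rewrite ger0_norm; last lra.
have : 0 <= (4 * y ^+ 2 - 1) * expR y by rewrite mulr_ge0 ?expR_ge0 //; nra.
by lra.
Qed.

Lemma sqr_sum_le (N : nat) (p : 'I_N -> R) :
  (\sum_c p c) ^+ 2 <= N%:R * \sum_c p c ^+ 2.
Proof.
case: N p => [|N] p; first by rewrite !big_ord0 expr0n mul0r.
set s := \sum_c p c; set q := \sum_c _; set M : R := N.+1%:R.
have M0 : 0 < M by rewrite ltr0n.
have : 0 <= \sum_c (p c - s / M) ^+ 2 by apply: sumr_ge0 => c _; exact: sqr_ge0.
under eq_bigr do rewrite sqrrB.
rewrite big_split sumrB /= sumr_const card_ord -[(_ ^+ 2) *+ _]mulr_natl -/q -/M.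
have -> : \sum_(i < N.+1) p i * (s / M) *+ 2 = 2 * s ^+ 2 / M.
  under eq_bigr do rewrite -mulr_natl.
  by rewrite -mulr_sumr -mulr_suml -/s; field; lra.
have -> : M * (s / M) ^+ 2 = s ^+ 2 / M by field; lra.
have -> : q - 2 * s ^+ 2 / M + s ^+ 2 / M = (M * q - s ^+ 2) / M by field; lra.
by rewrite pmulr_lge0 ?invr_gt0 // subr_ge0.
Qed.

(** Cauchy-Schwarz for the [N] probabilities of being in [B] and in cell [c], whose squares add up
    to the collision probability of two independent points. *)
Lemma collision_bound (T : finType) (N : nat) (g : T -> 'I_N) (B : pred T) :
  (avg (fun t => (B t)%:R) : R) ^+ 2 <=
  N%:R * avg (fun a => avg (fun b => [&& B a, B b & g a == g b]%:R)).
Proof.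
have -> : avg (fun t => (B t)%:R) =
    \sum_(c < N) avg (fun t => (B t && (g t == c))%:R) :> R.
  rewrite -avg_sum; apply: eq_avg => t.
  rewrite (bigD1 (g t)) //= eqxx andbT big1 ?addr0 // => c.
  by rewrite eq_sym => /negbTE ->; rewrite andbF.
apply: le_trans (sqr_sum_le _) _; rewrite ler_wpM2l ?ler0n //.
rewrite le_eqVlt; apply/orP; left; apply/eqP.
under eq_bigr do rewrite expr2 -avgZ.
rewrite -avg_sum; apply: eq_avg => a; under eq_bigr do rewrite mulrC -avgZ.
rewrite -avg_sum; apply: eq_avg => b.
rewrite (bigD1 (g a)) //= eqxx andbT -natrM mulnb big1 ?addr0 => [|c].
  by congr (_%:R); rewrite [g b == _]eq_sym !andbA.
by rewrite eq_sym => /negbTE ->; rewrite andbF mul0r.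
Qed.

Definition flip (I : finType) (i : I) (p : {ffun I -> bool}) : {ffun I -> bool} :=
  [ffun j => (j == i) (+) p j].

Lemma flipK (I : finType) (i : I) : involutive (flip i).
Proof. by move=> p; apply/ffunP => j; rewrite !ffunE addbA addbb. Qed.

Section Pair.
Variables (I : finType) (J : pred I) (x : I -> R) (i : I).
Hypothesis Ji : ~~ J i.

(** The Bernoulli sum Y: since [i] is outside [J], the agreements with the bit of [i] are
    independent fair bits. *)
Definition agree_sum (p : {ffun I -> bool}) : R := \sum_(j | J j) (p j == p i)%:R * x j.

Lemma agree_sum_flip (q : {ffun I -> bool}) :
  agree_sum (flip i q) = \sum_(j | J j) (q j != q i)%:R * x j.
Proof.
apply: eq_bigr => j Jj; rewrite !ffunE eqxx.
have /negbTE -> : j != i by apply: contraTneq Jj => ->.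
by case: (q j) (q i) => -[].
Qed.

(** Off the diagonal, toggling the bit of [j] negates the product; the agreement signs are
    orthonormal. *)
Lemma avg_sgn_agree (j l : I) : J j -> J l ->
  avg (fun p : {ffun I -> bool} => sgn R (p j == p i) * sgn R (p l == p i)) = (j == l)%:R.
Proof.
move=> Jj Jl; have [<-|jl] := eqVneq j l.
  rewrite -[RHS](avg_cst [ffun _ : I => true] 1); apply: eq_avg => p.
  by rewrite /sgn; case: ifP => _; lra.
set a := avg _; suff : a = - a by rewrite /=; lra.
rewrite {1}/a (avg_bij _ (inv_bij (flipK j))) -avgN; apply: eq_avg => p.
have ji : i == j = false by apply: contraTF Jj => /eqP <-.
rewrite !ffunE eqxx ji [l == j]eq_sym (negbTE jl) /= -mulNr; congr (_ * _).
by rewrite /sgn; case: (p j) (p i) => -[] /=; lra.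
Qed.

Lemma agree_sum_var :
  avg (fun p => (agree_sum p - (\sum_(j | J j) x j) / 2) ^+ 2) = (\sum_(j | J j) x j ^+ 2) / 4.
Proof.
transitivity (avg (fun p : {ffun I -> bool} => 4^-1 * \sum_(j | J j) \sum_(l | J l)
    (x j * x l) * (sgn R (p j == p i) * sgn R (p l == p i)))).
  apply: eq_avg => p.
  have -> : agree_sum p - (\sum_(j | J j) x j) / 2 =
      2^-1 * \sum_(j | J j) x j * sgn R (p j == p i).
    rewrite /agree_sum mulr_suml -sumrB mulr_sumr; apply: eq_bigr => j _.
    by rewrite /sgn; case: ifP => _ /=; lra.
  rewrite exprMn; congr (_ * _); first by lra.
  rewrite expr2 mulr_suml; apply: eq_bigr => j _; rewrite mulr_sumr.
  by apply: eq_bigr => l _; ring.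
rewrite avgZ avg_sum mulrC; congr (_ / _); apply: eq_bigr => j Jj.
rewrite avg_sum (bigD1 j) //= big1 ?addr0 => [|l /andP[Jl lj]].
  by rewrite avgZ avg_sgn_agree // eqxx mulr1 expr2.
by rewrite avgZ avg_sgn_agree // eq_sym (negbTE lj) mulr0.
Qed.

(** Chebyshev with variance at most 2V and squared radius 4V. *)
Lemma agree_sum_chebyshev (V : R) : 0 < V -> \sum_(j | J j) x j ^+ 2 <= 8 * V ->
  2^-1 <= avg (fun p => (`|agree_sum p - (\sum_(j | J j) x j) / 2| <= 2 * Num.sqrt V)%R%:R : R).
Proof.
move=> V0 xV; set c := _ / 2.
have : avg (fun p => 1 - (agree_sum p - c) ^+ 2 / (4 * V)) <=
    avg (fun p => (`|agree_sum p - c| <= 2 * Num.sqrt V)%R%:R : R).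
  apply: le_avg => p; have [_|gt] := leP `|agree_sum p - c| (2 * Num.sqrt V).
    by rewrite lerBlDr lerDl divr_ge0 ?sqr_ge0 //; lra.
  rewrite /= subr_le0 ler_pdivlMr ?mul1r; last by lra.
  rewrite -(ger0_norm (sqr_ge0 _)) normrX.
  have -> : 4 * V = (2 * Num.sqrt V) ^+ 2 by rewrite exprMn sqr_sqrtr ?ltW //; lra.
  by rewrite ler_sqr ?nnegrE ?mulr_ge0 ?sqrtr_ge0 // ltW.
apply: le_trans; rewrite avgD avgN (avg_cst [ffun _ => true]).
under [X in 1 - avg X]eq_fun do rewrite mulrC.
rewrite avgZ agree_sum_var.
have : (4 * V)^-1 * ((\sum_(j | J j) x j ^+ 2) / 4) <= 2^-1.
  rewrite mulrC ler_pdivrMr; last by lra.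
  by lra.
by lra.
Qed.

Lemma avg_ffun_pair (F : {ffun I -> bool} -> {ffun I -> bool} -> R) :
  avg (fun w : {ffun I -> bool * bool} => F [ffun j => (w j).1] [ffun j => (w j).2]) =
  avg (fun p => avg (F p)).
Proof.
pose h (w : {ffun I -> bool * bool}) := ([ffun j => (w j).1] : {ffun I -> bool}, [ffun j => (w
  j).2] : {ffun I -> bool}).
have hb : bijective h.
  exists (fun pq : {ffun I -> bool} * {ffun I -> bool} => [ffun j => (pq.1 j, pq.2 j)]).
    by move=> w; apply/ffunP => j; rewrite !ffunE; case: (w j).
  by case=> p q; congr (_, _); apply/ffunP => j; rewrite !ffunE.
have := avg_pair (fun pq : {ffun I -> bool} * {ffun I -> bool} => F pq.1 pq.2).
by rewrite (avg_bij _ hb).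
Qed.

(** With bucket parity p xor q and sign q, [j] meets [i] in a bucket when both bits agree (sign +)
    or both differ (sign -). The difference of indicators takes the same values and separates the
    two bits. *)
Definition pair_err (w : {ffun I -> bool * bool}) : R :=
  \sum_(j | J j) (((w j).1 == (w i).1)%:R - ((w j).2 != (w i).2)%:R) * x j.

(* pair_err is distributed as a difference Y - Y' of two independent copies of
   agree_sum; splitting the range where Y concentrates into cells of width
   rho * sqrt V, Cauchy-Schwarz bounds below the probability of a common cell. *)
Lemma pair_err_anticoncentration (V rho : R) :
  0 <= V -> 0 < rho <= 1 -> \sum_(j | J j) x j ^+ 2 <= 8 * V ->
  rho / 20 <= avg (fun w => (`|pair_err w| <= rho * Num.sqrt V)%R%:R).
Proof.
move=> V0 /andP[r0 r1] xV.
have [V00|Vn0] := eqVneq V 0.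
  have x0 j : J j -> x j = 0.
    move=> Jj; have : \sum_(j | J j) x j ^+ 2 <= 0 by lra.
    move=> s0; have /eqP : \sum_(j | J j) x j ^+ 2 == 0.
      by rewrite eq_le s0 sumr_ge0 // => *; exact: sqr_ge0.
    move=> /psumr_eq0P - /(_ (fun _ _ => sqr_ge0 _) j Jj) /eqP.
    by rewrite sqrf_eq0 => /eqP.
  apply: (@le_trans _ _ 1); first by lra.
  rewrite -[leLHS](avg_cst [ffun _ : I => (true, true)]); apply: le_avg => w.
  by rewrite /pair_err big1 ?normr0 ?V00 ?sqrtr0 ?mulr0 ?lexx // => j /x0 ->; rewrite mulr0.
have {Vn0}V0 : 0 < V by rewrite lt_neqAle eq_sym Vn0.
have sV : 0 < Num.sqrt V by rewrite sqrtr_gt0.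
set t := rho * Num.sqrt V; have t0 : 0 < t by rewrite mulr_gt0.
set c := (\sum_(j | J j) x j) / 2.
pose B (p : {ffun I -> bool}) := `|agree_sum p - c| <= 2 * Num.sqrt V.
pose N := Num.truncn (4 / rho : R).
pose cell (p : {ffun I -> bool}) := Num.truncn ((agree_sum p - c + 2 * Num.sqrt V) / t).
pose g p : 'I_N.+1 := inord (cell p).
have Bpos p : B p -> 0 <= (agree_sum p - c + 2 * Num.sqrt V) / t.
  by rewrite /B ler_norml => /andP[h _]; rewrite divr_ge0 ?(ltW t0) //; lra.
have cellN p : B p -> (cell p < N.+1)%N.
  move=> Bp; rewrite ltnS; apply: le_truncn.
  rewrite ler_pdivrMr //; have -> : 4 / rho * t = 4 * Num.sqrt V by rewrite /t; field; lra.
  by move: Bp; rewrite /B ler_norml => /andP[_ h]; lra.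
have close p q : [&& B p, B q & g p == g q] -> `|agree_sum p - agree_sum q| <= t.
  case/and3P => Bp Bq /eqP /(congr1 val); rewrite /= !inordK ?cellN // => pq.
  have /andP[p1 p2] := truncn_itv (Bpos _ Bp); have /andP[q1 q2] := truncn_itv (Bpos _ Bq).
  move: p1 p2 q1 q2; rewrite -/(cell p) -/(cell q) pq !ler_pdivlMr // !ltr_pdivrMr // -natr1.
  by rewrite ler_norml => *; apply/andP; split; lra.
have := collision_bound g B; have := agree_sum_chebyshev V0 xV.
set b := avg _; rewrite -/b => b2 cb.
have N5 : N.+1%:R <= 5 / rho.
  have : N%:R <= 4 / rho by rewrite truncn_le // divr_ge0 //; lra.
  have : 1 <= rho^-1 by rewrite invf_ge1.
  by rewrite -natr1; lra.
set s := avg _ in cb; have s4 : 4^-1 <= 5 / rho * s.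
  have s0 : 0 <= s by apply: avg_ge0 => p; apply: avg_ge0 => q; rewrite ler0n.
  have := ler_wpM2r s0 N5; have b4 : 4^-1 <= b ^+ 2 by nra.
  lra.
have : rho / 20 <= s.
  have -> : s = rho / 5 * (5 / rho * s) by field; lra.
  have -> : rho / 20 = rho / 5 * 4^-1 by field.
  by rewrite ler_pM2l //; lra.
move=> /le_trans; apply; rewrite /s.
apply: (@le_trans _ _ (avg (fun p => avg (fun q => (`|agree_sum p - agree_sum q| <= t)%R%:R)))).
  apply: le_avg => p; apply: le_avg => q; rewrite ler_nat.
  by case: (boolP [&& _, _ & _]) => // /close ->.
(* Toggling the bit of [i] in the second copy turns its agreements into disagreements, the second
   indicator of [pair_err]. *)
rewrite (eq_avg (fun p => avg_bij _ (inv_bij (flipK i)))) -avg_ffun_pair.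
rewrite le_eqVlt; apply/orP; left; apply/eqP; apply: eq_avg => w.
rewrite agree_sum_flip /agree_sum -sumrB; congr ((`|_| <= t)%R%:R); apply: eq_bigr => j _.
by rewrite !ffunE mulrBl.
Qed.

End Pair.
End AntiConcentration.

(** * Joint exponential moments *)

Section Row.
Variables (R : realType) (n k : nat) (T : finType) (t0 : T) (x : 'I_n -> R) (V : R).
Hypotheses (V0 : 0 <= V) (kn : (k <= n)%N) (kT : (4 * k <= #|T|)%N).
Hypothesis xV : \sum_(i < n | (k <= i)%N) x i ^+ 2 <= V * #|T|%:R.

Implicit Types (th : {ffun 'I_n -> T}) (w : {ffun 'I_n -> bool * bool}) (i : 'I_n).

Definition row_err th w i : R := pair_err (fun j => (j != i) && (th j == th i)) x i w.

Definition light th i : bool :=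
  [forall j, (j != i) && (th j == th i) ==> (k <= j)%N] &&
  (\sum_(j | (j != i) && (k <= j)%N) (th j == th i)%:R * x j ^+ 2 <= 8 * V).

Lemma T_gt0 : 0 < #|T|%:R :> R.
Proof. by rewrite ltr0n; apply/card_gt0P; exists t0. Qed.

Lemma avg_collide i j : i != j ->
  avg (fun th => (th j == th i)%:R) = #|T|%:R^-1 :> R.
Proof.
move=> ij; pose F (c : T) (l : 'I_n) (t : T) : R :=
  if (l == i) || (l == j) then (t == c)%:R else 1.
transitivity (avg (fun th => \sum_c \prod_l F c l (th l))).
  apply: eq_avg => th; rewrite (bigD1 (th i)) //= [X in _ + X]big1 ?addr0 => [|c ci].
    rewrite (bigD1 i) //= (bigD1 j) 1?eq_sym //= big1 => [|l /andP[li lj]].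
      by rewrite /F !eqxx orbT mul1r mulr1 eq_sym.
    by rewrite /F (negbTE li) (negbTE lj).
  by rewrite (bigD1 i) //= /F eqxx [th i == c]eq_sym (negbTE ci) mul0r.
rewrite avg_sum.
have single (c : T) : avg (fun t : T => (t == c)%:R) = #|T|%:R^-1 :> R.
  by rewrite /avg (bigD1 c) //= eqxx big1 ?addr0 ?mul1r // => t /negbTE ->.
under eq_bigr => c _.
  rewrite avg_ffun_prod (bigD1 i) //= (bigD1 j) 1?eq_sym //= big1 => [|l /andP[li lj]].
    rewrite {1}/F {1}/F eqxx eqxx orbT /= single mulr1; over.
  by rewrite /F (negbTE li) (negbTE lj) (avg_cst t0).
rewrite sumr_const -[(_ * _) *+ _]mulr_natl mulrA divff ?mul1r //.
by rewrite gt_eqF ?T_gt0.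
Qed.

(** The expected number of head coordinates meeting [i] is at most k / |T| <= 1/4; by Markov the
    tail mass, of mean at most V, exceeds 8V with probability at most 1/8. *)
Lemma avg_light i : 2^-1 <= avg (fun th => (light th i)%:R : R).
Proof.
have T0 := T_gt0; have V0' := V0.
pose S th := \sum_(j | (j != i) && (k <= j)%N) (th j == th i)%:R * x j ^+ 2.
have S0 th : 0 <= S th by apply: sumr_ge0 => j _; rewrite mulr_ge0 ?sqr_ge0.
have bad th : 1 - (\sum_(j < n | (j != i) && (j < k)%N) (th j == th i)%:R + (8 * V)^-1 * S th)
    <= (light th i)%:R.
  set A := \sum_(j < n | _) _; have A0 : 0 <= A by apply: sumr_ge0.
  have V8 : 0 <= (8 * V)^-1 by rewrite invr_ge0 mulr_ge0.
  have VS := mulr_ge0 V8 (S0 th).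
  rewrite /light; case: (boolP [forall _, _]) => [_|]; last first.
    rewrite negb_forall => /existsP[j]; rewrite negb_imply -ltnNge => /andP[/andP[ji thij] jk].
    rewrite /= /A (bigD1 j) ?ji //= thij.
    have : 0 <= \sum_(l < n | (l != i) && (l < k)%N && (l != j)) (th l == th i)%:R :> R by
      apply: sumr_ge0.
    by rewrite /=; lra.
  rewrite -/(S th); have [_|SV] := leP (S th) (8 * V); first by rewrite /=; lra.
  (* For [V = 0] the coefficient of the Markov term is the inverse of 0, hence 0; but then [xV]
     leaves no tail mass. *)
  have Vp : 0 < V.
    rewrite lt_neqAle V0 andbT eq_sym; apply/eqP => V00.
    have : S th <= \sum_(j < n | (k <= j)%N) x j ^+ 2.
      rewrite [leRHS](bigID (fun j => j != i)) /=.
      apply: ler_wpDr; first by apply: sumr_ge0 => *; rewrite sqr_ge0.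
      rewrite /S [leLHS](eq_bigl (fun j : 'I_n => (k <= j)%N && (j != i))); last by move=> j;
        rewrite andbC.
      by apply: ler_sum => j _; rewrite ler_piMl ?sqr_ge0 // lern1 leq_b1.
    by move: xV SV; rewrite V00 mul0r; lra.
  suff : 1 <= (8 * V)^-1 * S th by rewrite /=; lra.
  by rewrite mulrC ler_pdivlMr ?mul1r ?ltW //; lra.
apply: le_trans (le_avg bad).
rewrite avgD avgN avgD (avg_cst [ffun=> t0]) avgZ.
rewrite avg_sum avg_sum.
have h1 : \sum_(j < n | (j != i) && (j < k)%N) avg (fun th => (th j == th i)%:R) <= 4^-1 :> R.
  apply: (@le_trans _ _ (\sum_(j < n | (j < k)%N) #|T|%:R^-1)).
    rewrite [leRHS](bigID (fun j => j != i)) /=.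
    apply: ler_wpDr; first by apply: sumr_ge0 => *; rewrite invr_ge0 ltW.
    rewrite [leLHS](eq_bigl (fun j : 'I_n => (j < k)%N && (j != i))); last by move=> j;
      rewrite andbC.
    by apply: ler_sum => j /andP[_ ji]; rewrite avg_collide // eq_sym.
  rewrite (big_ord_narrow kn) sumr_const card_ord -[(_ *+ _)]mulr_natl ler_pdivrMr //.
  by move: kT; rewrite -(ler_nat R) natrM; lra.
have h2 : \sum_(j < n | (j != i) && (k <= j)%N) avg (fun th => (th j == th i)%:R * x j ^+ 2)
  <= V.
  apply: (@le_trans _ _ (\sum_(j < n | (k <= j)%N) x j ^+ 2 / #|T|%:R)).
    rewrite [leRHS](bigID (fun j => j != i)) /=.
    apply: ler_wpDr; first by apply: sumr_ge0 => *; rewrite divr_ge0 ?sqr_ge0 // ltW.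
    rewrite [leLHS](eq_bigl (fun j : 'I_n => (k <= j)%N && (j != i))); last by move=> j;
      rewrite andbC.
    apply: ler_sum => j /andP[_ ji]; under [X in avg X]eq_fun do rewrite mulrC.
    by rewrite avgZ avg_collide // eq_sym.
  by rewrite -mulr_suml ler_pdivrMr.
have h3 : (8 * V)^-1 * V <= 8^-1.
  have [->|Vn] := eqVneq V 0; first by rewrite mulr0; lra.
  by rewrite invfM -mulrA mulVf // mulr1.
have : (8 * V)^-1 * \sum_(j < n | (j != i) && (k <= j)%N) avg (fun th => (th j == th i)%:R * x
  j ^+ 2)
   <= (8 * V)^-1 * V by rewrite ler_wpM2l // invr_ge0; lra.
by lra.
Qed.

(** The symmetry that negates the error of [i]: it exchanges joint agreement with joint
    disagreement. *)
Definition flip2 i w : {ffun 'I_n -> bool * bool} :=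
  [ffun j => ((j == i) (+) (w j).1, (j == i) (+) (w j).2)].

Lemma flip2K i : involutive (flip2 i).
Proof. by move=> w; apply/ffunP => j; rewrite !ffunE /= !addbA addbb; case: (w j). Qed.

Lemma row_err_flip2 th w i : row_err th (flip2 i w) i = - row_err th w i.
Proof.
rewrite /row_err /pair_err -sumrN; apply: eq_bigr => j /andP[/negbTE ji _].
rewrite !ffunE eqxx ji /= -mulNr; congr (_ * _).
by case: (w j) (w i) => [[] []] [[] []] /=; lra.
Qed.

Definition hit (tau : R) (o : bool) th w i : bool := tau < sgn R o * row_err th w i.

(** By the symmetry [flip2] both signs of a large error are equally likely, and they exclude each
    other as [tau] is nonnegative. *)
Lemma avg_hit tau o th i : 0 <= tau ->
  avg (fun w => (hit tau o th w i)%:R) =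
  (1 - avg (fun w => (`|row_err th w i| <= tau)%R%:R)) / 2 :> R.
Proof.
move=> tau0.
have eqh : avg (fun w => (hit tau (~~ o) th w i)%:R) = avg (fun w => (hit tau o th w i)%:R) :>
  R.
  rewrite (avg_bij _ (inv_bij (flip2K i))); apply: eq_avg => w.
  by rewrite /hit row_err_flip2 mulrN -mulNr; congr ((_ < _ * _)%R%:R); case: o;
    rewrite /sgn /=; lra.
have : avg (fun w => (hit tau (~~ o) th w i)%:R + (hit tau o th w i)%:R) =
   avg (fun w => 1 - (`|row_err th w i| <= tau)%R%:R) :> R.
  apply: eq_avg => w; rewrite /hit; set e := row_err _ _ _.
  have [ot|ot] := leP `|e| tau.
    have /andP[e1 e2] : - tau <= e <= tau by rewrite -ler_norml.
    rewrite !ltNge; have -> : sgn R (~~ o) * e <= tau by clear eqh; case: o; rewrite /sgn /=;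
      lra.
    by have -> : sgn R o * e <= tau; [clear eqh; case: o; rewrite /sgn /=; lra | rewrite /=;
      lra].
  move: ot; rewrite /= subr0 ltr_normr => /orP[] ot.
    by clear eqh; case: o; rewrite /sgn /= !mul1r !mulN1r ot ?[tau < - e]ltNge ?[- e <=
      tau]ltW /= ?add0r ?addr0 //; lra.
  by clear eqh; case: o; rewrite /sgn /= !mul1r !mulN1r ot ?[tau < e]ltNge ?[e <= tau]ltW /=
    ?add0r ?addr0 //; lra.
rewrite avgD eqh avgD avgN (avg_cst [ffun=> (true, true)]); lra.
Qed.

Section Tuple.
Variables (m : nat) (f : 'I_m -> 'I_n) (o : 'I_m -> bool) (rho lam : R).
Hypotheses (rho01 : 0 < rho <= 1) (lam01 : 0 <= lam <= 1).

(** Centred at 1/2 because a wrong median needs half of the rows to err on one side, which makes the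
    total over the rows nonnegative. *)
Definition excess th w : R :=
  \sum_r ((hit (rho * Num.sqrt V) (o r) th w (f r))%:R - 2^-1).

Lemma rho_sqrt_ge0 : 0 <= rho * Num.sqrt V.
Proof. by case/andP: rho01 => r0 _; rewrite mulr_ge0 ?sqrtr_ge0 // ltW. Qed.

(** The centred indicator has square 1/4, whence lam^2 / 2. Its mean is at most 0 by [avg_hit], and
    at most - rho / 40 for a light coordinate by anticoncentration. *)
Lemma avg_expR_hit th r :
  avg (fun w => expR (lam * ((hit (rho * Num.sqrt V) (o r) th w (f r))%:R - 2^-1))) <=
  expR (lam ^+ 2 / 2 - lam * rho / 40 * (light th (f r))%:R).
Proof.
case/andP: lam01 => l0 l1; case/andP: (rho01) => r0 r1.
pose h w : R := (hit (rho * Num.sqrt V) (o r) th w (f r))%:R.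
apply: (@le_trans _ _ (avg (fun w => (1 - lam / 2 + lam ^+ 2 / 2) + lam * h w))).
  apply: le_avg => w; apply: le_trans (expR_le_quad _) _.
    by rewrite /h; case: (hit _ _ _ _ _) => /=; lra.
  by rewrite /h; case: (hit _ _ _ _ _) => /=; lra.
rewrite avgD (avg_cst [ffun=> (true, true)]) avgZ /h avg_hit ?rho_sqrt_ge0 //.
set p := avg _.
have pl : rho / 20 * (light th (f r))%:R <= p.
  rewrite /light; case: (boolP [forall _, _]) => [/forallP all|_] /=; last first.
    by rewrite mulr0; apply: avg_ge0.
  case: (leP _ (8 * V)) => /= S8; last by rewrite mulr0; apply: avg_ge0.
  rewrite mulr1; apply: pair_err_anticoncentration => //; first by rewrite eqxx.
  apply: le_trans S8; rewrite le_eqVlt; apply/orP; left; apply/eqP.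
  rewrite big_mkcond [RHS]big_mkcond; apply: eq_bigr => j _.
  have := all j; case: (j == f r) => //=; case: (th j == th (f r)) => /=.
    by move=> ->; rewrite mul1r.
  by rewrite mul0r if_same.
apply: le_trans (expR_ge1Dx _).
have := ler_wpM2l l0 pl; lra.
Qed.

(** Coordinates in distinct classes of [th] depend on disjoint sets of bits, so the exponential
    moment factorizes. *)
Lemma row_injective th : injective (th \o f) ->
  avg (fun w => expR (lam * excess th w)) <=
  expR (m%:R * lam ^+ 2 / 2 - lam * rho / 40 * \sum_r (light th (f r))%:R).
Proof.
move=> thf; under [X in avg X]eq_fun do rewrite mulr_sumr expR_sum.
rewrite (avg_prod_indep (true, true) (B := fun r => [set j | th j == th (f r)])); first last.
- move=> r w w' ww'; rewrite /hit; have -> // : row_err th w (f r) = row_err th w' (f r).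
  apply: eq_bigr => j /andP[_ thj]; rewrite ww' ?inE // ww' // inE eqxx //.
- move=> r r' rr'; apply/pred0P => j /=; rewrite !inE; apply/negP => /andP[/eqP -> /eqP].
  by move/thf/eqP; exact/negP.
apply: (@le_trans _ _ (\prod_r expR (lam ^+ 2 / 2 - lam * rho / 40 * (light th (f r))%:R))).
  apply: ler_prod => r _; rewrite avg_expR_hit andbT.
  by apply: avg_ge0 => w; exact: expR_ge0.
rewrite -expR_sum ler_expR sumrB sumr_const card_ord -mulr_sumr -[_ *+ m]mulr_natl.
by rewrite mulrA.
Qed.

(** Without independence, the first-order term is still nonpositive because each hit has probability
    at most 1/2; the remainder uses |excess| <= m / 2. *)
Lemma row_any th :
  avg (fun w => expR (lam * excess th w)) <= 1 + (lam * m%:R) ^+ 2 * expR m%:R.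
Proof.
case/andP: lam01 => l0 l1; set M : R := m%:R; have M0 : 0 <= M by rewrite ler0n.
have exb w : `|excess th w| <= M / 2.
  apply: le_trans (ler_norm_sum _ _ _) _.
  apply: (@le_trans _ _ (\sum_(r < m) 2^-1)).
    apply: ler_sum => r _; case: (hit _ _ _ _ _) => /=.
      by rewrite ger0_norm; lra.
    by rewrite ler0_norm; lra.
  by rewrite sumr_const card_ord -[_ *+ m]mulr_natl.
apply: (@le_trans _ _ (avg (fun w => (1 + (lam * M) ^+ 2 * expR M) + lam * excess th w))).
  apply: le_avg => w; apply: le_trans (expR_le_quad_abs _) _.
  have lb : `|lam * excess th w| <= lam * M / 2.
    by rewrite normrM ger0_norm // -mulrA ler_wpM2l.
  have sq : (lam * excess th w) ^+ 2 <= (lam * M / 2) ^+ 2.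
    rewrite -real_normK ?num_real // ler_sqr ?nnegrE //.
    by rewrite divr_ge0 ?mulr_ge0.
  have ee : expR `|lam * excess th w| <= expR M.
    rewrite ler_expR; apply: le_trans lb _; nra.
  rewrite [leRHS]addrAC lerD2l.
  apply: (@le_trans _ _ (4 * (lam * M / 2) ^+ 2 * expR M)).
    apply: ler_pM => //; last by rewrite ler_wpM2l.
    by apply: mulr_ge0; rewrite ?sqr_ge0.
  by rewrite le_eqVlt; apply/orP; left; apply/eqP; field.
rewrite avgD (avg_cst [ffun=> (true, true)]) avgZ gerDl mulr_ge0_le0 //.
rewrite avg_sum; apply: sumr_le0 => r _.
rewrite avgD (avg_cst [ffun=> (true, true)]) avg_hit ?rho_sqrt_ge0 //.
have : 0 <= avg (fun w => (`|row_err th w (f r)| <= rho * Num.sqrt V)%R%:R) :> R.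
  by apply: avg_ge0.
lra.
Qed.

End Tuple.
End Row.

(** * Several coordinates over independent rows *)

Section Rows.
Variables (R : realType) (n k : nat) (T : finType) (t0 : T) (x : 'I_n -> R) (V : R).
Hypotheses (V0 : 0 <= V) (kn : (k <= n)%N) (kT : (4 * k <= #|T|)%N).
Hypothesis xV : \sum_(i < n | (k <= i)%N) x i ^+ 2 <= V * #|T|%:R.

Section Tuple.
Variables (m : nat) (f : 'I_m -> 'I_n) (rho : R).
Hypotheses (finj : injective f) (rho01 : 0 < rho <= 1).

Lemma avg_not_injective :
  avg (fun th : {ffun 'I_n -> T} => (~~ injectiveb (th \o f))%:R) <= m%:R ^+ 2 / #|T|%:R :> R.
Proof.
apply: (@le_trans _ _ (avg (fun th : {ffun 'I_n -> T} =>
    \sum_(r : 'I_m) \sum_(r' : 'I_m | r' != r) (th (f r') == th (f r))%:R))).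
  apply: le_avg => th; case: (boolP (injectiveb _)) => [_|/injectivePn[r [r' rr' e]]] /=.
    by apply: sumr_ge0 => r _; apply: sumr_ge0.
  rewrite (bigD1 r) //= (bigD1 r') /=; last by rewrite eq_sym.
  have -> : th (f r') == th (f r) by apply/eqP; rewrite /= in e.
  by rewrite -addrA lerDl addr_ge0 ?sumr_ge0 // => *; rewrite sumr_ge0.
rewrite avg_sum; apply: (@le_trans _ _ (\sum_(r < m) \sum_(r' < m) #|T|%:R^-1)).
  apply: ler_sum => r _; rewrite avg_sum [leRHS](bigID (fun r' => r' != r)) /=.
  apply: ler_wpDr; first by apply: sumr_ge0 => *; rewrite invr_ge0.
  apply: ler_sum => r' rr'; rewrite (avg_collide _ t0) //.
  by rewrite (inj_eq finj) eq_sym.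
by rewrite !sumr_const card_ord -[#|T|%:R^-1 *+ m]mulr_natl -[(_ * _) *+ m]mulr_natl mulrA.
Qed.

(* Given th, the counts for different r are independent when th \o f is injective;
   the tuples where it is not are rare enough for a crude second-order bound. *)
Lemma row_mgf (o : 'I_m -> bool) :
  m%:R * rho ^+ 2 <= 1 ->
  320 * (m%:R ^+ 2 * (1 + m%:R * expR m%:R)) <= #|T|%:R :> R ->
  avg (fun th : {ffun 'I_n -> T} => avg (fun w => expR (rho / 800 * excess x V f o rho th w)))
    <=
  expR (- (m%:R * rho ^+ 2 / (800 * 160))).
Proof.
move=> mrho mT; set M : R := m%:R in mrho mT *; have M0 : 0 <= M by rewrite ler0n.
have TT : 0 < #|T|%:R :> R := T_gt0 _ t0.
have /andP[r0 r1] := rho01.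
set E := expR M in mT *; have E0 : 0 < E by exact: expR_gt0.
set A := M * rho ^+ 2 in mrho *.
have A0 : 0 <= A by rewrite mulr_ge0 ?sqr_ge0.
have lam01 : 0 <= rho / 800 <= 1 by apply/andP; split; lra.
have lightS (th : {ffun 'I_n -> T}) : 0 <= (\sum_r (light k x V th (f r))%:R : R) <= M.
  apply/andP; split; first by apply: sumr_ge0.
  apply: (@le_trans _ _ (\sum_(r < m) 1)); last by rewrite sumr_const card_ord.
  by apply: ler_sum => r _; rewrite lern1 leq_b1.
have ME : 0 <= M * E by rewrite mulr_ge0 // ltW.
(* In units of A / 800: light coordinates gain 1/80 on average, the second order loses 1/320, and
   non-injective tuples lose 1/320 by the bound on [#|T|]. The net gain is 1/160. *)
apply: (@le_trans _ _ (avg (fun th => (1 + A / (800 * 320) +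
    (- (rho ^+ 2 / (800 * 40))) * \sum_r (light k x V th (f r))%:R) +
    (A / 800 * (1 + M * E)) * (~~ injectiveb (th \o f))%:R))).
  apply: le_avg => th; have /andP[L0 LM] := lightS th.
  set L := \sum_r _ in L0 LM *.
  have l0 : 0 <= rho ^+ 2 * L by rewrite mulr_ge0 ?sqr_ge0.
  have lA : rho ^+ 2 * L <= A by rewrite /A mulrC ler_wpM2r ?sqr_ge0.
  case: (boolP (injectiveb _)) => [/injectiveP thf|_] /=.
    apply: le_trans (row_injective k x V0 o rho01 lam01 thf) _.
    rewrite -/L -/M.
    have -> : M * (rho / 800) ^+ 2 / 2 - rho / 800 * rho / 40 * L =
      A / (800 * 1600) - (rho ^+ 2 * L) / (800 * 40) by rewrite /A; field.
    have -> : 1 + A / (800 * 320) + - (rho ^+ 2 / (800 * 40)) * L = 1 + A / (800 * 320) - (rho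
      ^+ 2 * L) / (800 * 40).
      by field.
    move: (rho ^+ 2 * L) l0 lA => l l0 lA.
    apply: le_trans (expR_le_quad _) _; first by lra.
    have : (A / (800 * 1600) - l / (800 * 40)) ^+ 2 <= A / (800 * 1600).
      have : - A / (800 * 40) <= A / (800 * 1600) - l / (800 * 40) <= A / (800 * 40) by
        apply/andP; split; lra.
      by move=> /andP[]; nra.
    by lra.
  apply: le_trans (row_any x V f o rho01 lam01 th) _.
  rewrite -/M -/E.
  have -> : (rho / 800 * M) ^+ 2 * E = A * (M * E) / (800 * 800) by rewrite /A; field.
  have -> : - (rho ^+ 2 / (800 * 40)) * L = - (rho ^+ 2 * L / (800 * 40)) by field.
  by nra.
rewrite avgD avgD (avg_cst [ffun=> t0]) !avgZ avg_sum.
have h1 : M / 2 <= \sum_r avg (fun th : {ffun 'I_n -> T} => (light k x V th (f r))%:R) :> R.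
  apply: (@le_trans _ _ (\sum_(r < m) (2^-1 : R))).
    by rewrite sumr_const card_ord -[_ *+ m]mulr_natl.
  by apply: ler_sum => r _; exact: avg_light.
have h2 := avg_not_injective; rewrite -/M in h2.
have h3 : rho ^+ 2 / (800 * 40) * (M / 2) <=
    rho ^+ 2 / (800 * 40) * \sum_r avg (fun th : {ffun 'I_n -> T} => (light k x V th (f
      r))%:R) :> R.
  apply: ler_wpM2l h1; have := sqr_ge0 rho; lra.
have h4 : A / 800 * (1 + M * E) *
    avg (fun th : {ffun 'I_n -> T} => (~~ injectiveb (th \o f))%:R) <= A / 800 * 320^-1 :> R.
  rewrite -mulrA; apply: ler_wpM2l; first by lra.
  apply: (@le_trans _ _ ((1 + M * E) * (M ^+ 2 / #|T|%:R))).
    by rewrite ler_wpM2l //; lra.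
  by rewrite mulrA ler_pdivrMr //; lra.
have h5 : rho ^+ 2 / (800 * 40) * (M / 2) = A / (800 * 80) by rewrite /A; field.
apply: le_trans (expR_ge1Dx _).
by rewrite mulNr; lra.
Qed.

End Tuple.

Section Tail.
Variable rows : nat.

Definition sample := {ffun 'I_rows -> {ffun 'I_n -> T} * {ffun 'I_n -> bool * bool}}.

(** What a median error above [tau] forces: at least half of the rows err by more than [tau] on a
    common side [o]. *)
Definition far (tau : R) (om : sample) (i : 'I_n) : bool :=
  [exists o, (rows <= 2 * #|[pred u | hit x tau o (om u).1 (om u).2 i]|)%N].

(** A far coordinate has a side with nonnegative total excess, so an exponential moment dominates
    the indicator. Summing over the side vectors costs [2 ^+ m]; independence raises [row_mgf] to
    the power [rows]. *)
Lemma tuple_tail (m : nat) (f : 'I_m -> 'I_n) (rho : R) :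
  injective f -> 0 < rho <= 1 -> m%:R * rho ^+ 2 <= 1 ->
  320 * (m%:R ^+ 2 * (1 + m%:R * expR m%:R)) <= #|T|%:R :> R ->
  avg (fun om => [forall r, far (rho * Num.sqrt V) om (f r)]%:R) <=
  2 ^+ m * expR (- (m%:R * rho ^+ 2 * rows%:R / (800 * 160))).
Proof.
move=> finj rho01 mrho mT; have /andP[r0 r1] := rho01.
set tau := rho * Num.sqrt V; have lam0 : 0 <= rho / 800 by lra.
pose ex (o : {ffun 'I_m -> bool}) (p : {ffun 'I_n -> T} * {ffun 'I_n -> bool * bool}) : R :=
  expR (rho / 800 * excess x V f o rho p.1 p.2).
apply: (@le_trans _ _ (avg (fun om : sample => \sum_o \prod_u ex o (om u)))).
  apply: le_avg => om.
  (* Distributivity: the sum over side vectors becomes a product over coordinates of two-term sums,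
     so each coordinate may choose its own side. *)
  have -> : \sum_o \prod_u ex o (om u) = \prod_(r < m) \sum_(o : bool)
      expR (rho / 800 * \sum_u ((hit x tau o (om u).1 (om u).2 (f r))%:R - 2^-1)).
    rewrite bigA_distr_bigA; apply: eq_bigr => o _; rewrite /ex -!expR_sum.
    congr expR; rewrite -!mulr_sumr; congr (_ * _).
    by rewrite exchange_big.
  case: (boolP [forall _, _]) => [/forallP farf|_]; last first.
    by apply: prodr_ge0 => r _; apply: sumr_ge0 => o _; exact: expR_ge0.
  apply: (@le_trans _ _ (\prod_(r < m) 1)); first by rewrite big1_eq.
  apply: ler_prod => r _; rewrite ler01 /=.
  have /existsP[b hb] := farf r.
  rewrite (bigD1 b) //=; apply: ler_wpDr; first by apply: sumr_ge0 => *; exact: expR_ge0.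
  rewrite -[leLHS]expR0 ler_expR; apply: (mulr_ge0 lam0).
  rewrite sumrB sumr_const card_ord -natr_sum -[_ *+ rows]mulr_natr.
  have -> : (\sum_(u < rows) hit x tau b (om u).1 (om u).2 (f r))%N =
     #|[pred u | hit x tau b (om u).1 (om u).2 (f r)]|.
    by rewrite -sum1_card [RHS]big_mkcond; apply: eq_bigr => u _; rewrite inE; case: hit.
  by move: hb; rewrite -(ler_nat R) natrM; lra.
rewrite avg_sum.
apply: (@le_trans _ _ (\sum_(o : {ffun 'I_m -> bool}) expR (- (m%:R * rho ^+ 2 / (800 * 160)))
  ^+ rows)).
  apply: ler_sum => o _; rewrite (avg_ffun_prod (fun _ => ex o)) prodr_const card_ord.
  rewrite lerXn2r ?nnegrE ?expR_ge0 //; first by apply: avg_ge0 => p; exact: expR_ge0.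
  by rewrite avg_pair; exact: row_mgf.
rewrite sumr_const card_ffun card_bool card_ord -[_ *+ _]mulr_natl natrX -expRM_natl.
by rewrite ler_wpM2l ?exprn_ge0 // ler_expR; lra.
Qed.

End Tail.
End Rows.

(** * Medians and top-k sets *)

Section Median.
Variable R : realType.
Implicit Types (s t : seq R) (v : R).

Lemma sorted_count_gt t v j : sorted <=%R t -> (j < size t)%N -> v < nth 0 t j ->
  (size t - j <= count (fun y => (v < y)%R) t)%N.
Proof.
move=> st jt vj; rewrite -{2}(cat_take_drop j t) count_cat -size_drop.
apply: leq_trans (leq_addl _ _); rewrite leqNgt; apply/negP => lt.
suff : all (fun y => (v < y)%R) (drop j t) by rewrite all_count => /eqP E; rewrite E ltnn in lt.
apply/(all_nthP 0) => l; rewrite size_drop nth_drop => lj; apply: lt_le_trans vj _.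
by apply: (sorted_leq_nth le_trans lexx 0 st); rewrite ?inE ?leq_addr // -ltn_subRL.
Qed.

Lemma sorted_count_lt t v j : sorted <=%R t -> (j < size t)%N -> nth 0 t j < v ->
  (j < count (fun y => (y < v)%R) t)%N.
Proof.
move=> st jt vj; rewrite -{1}(cat_take_drop j.+1 t) count_cat.
apply: leq_trans (leq_addr _ _).
have sj : size (take j.+1 t) = j.+1 by exact: size_takel.
suff : all (fun y => (y < v)%R) (take j.+1 t) by rewrite all_count => /eqP ->; rewrite sj.
apply/(all_nthP 0) => l; rewrite sj => lj; rewrite nth_take //; apply: le_lt_trans vj.
by apply: (sorted_leq_nth le_trans lexx 0 st); rewrite ?inE // (leq_trans lj jt).
Qed.

Lemma sort_le_sorted s : sorted <=%R (sort <=%R s).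
Proof. exact/sort_sorted/le_total. Qed.

Lemma half_lt (N : nat) : (0 < N)%N -> (N./2 < N)%N.
Proof. by have := odd_double_half N; lia. Qed.

(** For even size the mean of the two middle entries is at most the upper one; in either parity the
    entry at half the size, and all later ones, exceed [v]. *)
Lemma median_gt s v : (0 < size s)%N -> v < median s ->
  (size s <= 2 * count (fun y => (v < y)%R) s)%N.
Proof.
rewrite /median -(permP (permEl (perm_sort <=%R s))) -(size_sort <=%R s).
move: (sort_le_sorted s); set t := sort _ s => st t0 vm.
have twice (N c : nat) : (N - N./2 <= c -> N <= 2 * c)%N by have := odd_double_half N; lia.
apply/twice/sorted_count_gt => //; first exact: half_lt.
have lt : nth 0 t (size t)./2.-1 <= nth 0 t (size t)./2.
  by apply: (sorted_leq_nth le_trans lexx 0 st); rewrite ?inE ?leq_pred ?(leq_ltn_trans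
    (leq_pred _)) ?half_lt.
by move: vm; case: ifP => // _ vm; lra.
Qed.

Lemma median_lt s v : (0 < size s)%N -> median s < v ->
  (size s <= 2 * count (fun y => (y < v)%R) s)%N.
Proof.
rewrite /median -(permP (permEl (perm_sort <=%R s))) -(size_sort <=%R s).
move: (sort_le_sorted s); set t := sort _ s => st t0.
case: ifP => od vm.
  have twice (N c : nat) : odd N -> (N./2 < c -> N <= 2 * c)%N.
    by move=> oN; have := odd_double_half N; rewrite oN; lia.
  by apply/(twice _ _ od)/sorted_count_lt => //; exact: half_lt.
have lt : nth 0 t (size t)./2.-1 <= nth 0 t (size t)./2.
  by apply: (sorted_leq_nth le_trans lexx 0 st); rewrite ?inE ?leq_pred ?(leq_ltn_trans
    (leq_pred _)) ?half_lt.
have twice (N c : nat) : odd N = false -> (N./2.-1 < c -> N <= 2 * c)%N.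
  by move=> oN; have := odd_double_half N; rewrite oN; lia.
apply/(twice _ _ od)/sorted_count_lt => //; last by lra.
by rewrite (leq_ltn_trans (leq_pred _)) ?half_lt.
Qed.

End Median.

Section TopK.
Variables (R : realType) (n k : nat).
Hypothesis kn : (2 * k <= n)%N.

(** An index past 2k, or one preceded by such an index, is already preceded by the k head
    coordinates; so membership is decided within the first 2k. *)
Lemma topk_lt (z : 'I_n -> R) (i : 'I_n) :
  (forall i j : 'I_n, (2 * k <= i)%N -> (j < k)%N -> `|z i| < `|z j|) ->
  i \in topk_set k z =
  (i < 2 * k)%N && (#|[set j : 'I_n | (j < 2 * k)%N && mag_before z j i]| < k)%N.
Proof.
move=> zk; rewrite inE.
have kk : #|[set j : 'I_n | (j < k)%N]| = k.
  have kn' : (k <= n)%N by lia.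
  rewrite -sum1_card (eq_bigl (fun j : 'I_n => (j < k)%N)) => [|j]; last by rewrite inE.
  by rewrite (big_ord_narrow kn') sum1_card card_ord.
case: (ltnP i (2 * k)) => ik /=; last first.
  apply/negbTE; rewrite -leqNgt -{1}kk; apply/subset_leq_card/fintype.subsetP => j.
  by rewrite !inE => jk; rewrite /mag_before zk.
have [[j /andP[j2 ji]]|no] := pselect (exists j : 'I_n, (2 * k <= j)%N && mag_before z j i).
  have kb : (k <= #|[set l : 'I_n | (l < 2 * k)%N && mag_before z l i]|)%N.
    rewrite -{1}kk; apply/subset_leq_card/fintype.subsetP => l; rewrite !inE => lk.
    have -> : (l < 2 * k)%N by lia.
    have := zk _ _ j2 lk; rewrite /mag_before /= in ji *.
    by case/orP: ji => [/lt_trans h /h -> //|/andP[/eqP -> _] ->].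
  rewrite !ltnNge kb; congr (~~ _).
  apply: leq_trans kb _; apply/subset_leq_card/fintype.subsetP => l.
  by rewrite !inE => /andP[].
congr (_ < _)%N; apply: eq_card => j; rewrite !inE.
case: (ltnP j (2 * k)) => //= j2; apply/negP => ji; apply: no; exists j; rewrite j2; exact: ji.
Qed.

(* A candidate for the minimum: keep the estimate on the first 2k coordinates and
   the true values elsewhere. *)
Lemma Ek_le (x xhat : 'I_n -> R) (g : R) :
  (forall i j : 'I_n, (2 * k <= i)%N -> (j < k)%N -> `|x i| + 2 * g < `|x j|) ->
  (forall i, `|xhat i - x i| <= g) ->
  Ek k x xhat ^+ 2 <= \sum_(i < n | (i < 2 * k)%N) (xhat i - x i) ^+ 2.
Proof.
move=> gap close.
pose x' (i : 'I_n) := if (i < 2 * k)%N then xhat i else x i.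
have lo i : `|x i| - g <= `|xhat i| by have := ler_dist_dist (xhat i) (x i); have := close i;
  rewrite ler_norml; move=> a /le_trans/(_ (close i)); rewrite ler_norml; lra.
have hi i : `|xhat i| <= `|x i| + g by have := ler_dist_dist (xhat i) (x i);
  move=> /le_trans/(_ (close i)); rewrite ler_norml; lra.
have topE : topk_set k x' = topk_set k xhat.
  apply/setP => i; rewrite !topk_lt; first 1 last.
  - by move=> {}i j i2 jk; have := gap _ _ i2 jk; have := lo j; have := hi i; lra.
  - move=> {}i j i2 jk; rewrite /x' ltnNge i2 /=; have -> : (j < 2 * k)%N by lia.
    by have := gap _ _ i2 jk; have := lo j; have := le_trans (normr_ge0 _) (close i); lra.
  case: (ltnP i (2 * k)) => //= ik; congr (_ < _)%N; apply: eq_card => j; rewrite !inE.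
  by case: (ltnP j (2 * k)) => //= jk; rewrite /mag_before /x' ik jk.
have HkE i : Hk k x' i = Hk k xhat i.
  rewrite /Hk topE; case: ifP => // it; rewrite /x'.
  move: it; rewrite topk_lt => [/andP[-> //]|{}i j i2 jk].
  by have := gap _ _ i2 jk; have := lo j; have := hi i; lra.
pose E := [set norm2 (fun i => x i - x' i) |
       x' in [set x' : 'I_n -> R | forall i, Hk k x' i = Hk k xhat i]]%classic.
have n0 y : 0 <= norm2 y :> R by rewrite sqrtr_ge0.
have Ex : E (norm2 (fun i => x i - x' i)) by exists x'.
have E0 : 0 <= Ek k x xhat.
  by apply: lb_le_inf; [exists (norm2 (fun i => x i - x' i)) | move=> _ [y _ <-]].
have El : Ek k x xhat <= norm2 (fun i => x i - x' i).
  by apply: ge_inf => //; exists 0 => _ [y _ <-].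
apply: (@le_trans _ _ (norm2 (fun i => x i - x' i) ^+ 2)).
  by rewrite ler_sqr ?nnegrE.
rewrite sqr_sqrtr; last by apply: sumr_ge0 => i _; rewrite sqr_ge0.
rewrite (bigID (fun i : 'I_n => (i < 2 * k)%N)) /= [X in _ + X]big1 ?addr0 => [|i /negbTE i2].
  by apply: ler_sum => i i2; rewrite /x' i2 -sqrrN opprB.
by rewrite /x' i2 subrr expr0n.
Qed.

(** Covers a zero tail, for which the gap need not be strict. *)
Lemma Ek_self (x xhat : 'I_n -> R) : (forall i, xhat i = x i) -> Ek k x xhat ^+ 2 = 0.
Proof.
move=> e; suff -> : Ek k x xhat = 0 by rewrite expr0n.
apply/eqP; rewrite eq_le; apply/andP; split.
  apply: ge_inf; first by exists 0 => _ [y _ <-]; rewrite sqrtr_ge0.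
  exists xhat => //; rewrite /norm2 big1 ?sqrtr0 // => i _; rewrite e subrr expr0n //.
apply: lb_le_inf; first by exists (norm2 (fun i => x i - xhat i)); exists xhat.
by move=> _ [y _ <-]; rewrite sqrtr_ge0.
Qed.

End TopK.

(** * The number of coordinates with a large error *)

Section Encoding.
Variables (R : realType) (n rows C : nat) (T : finType).
Variables (phi : T * bool -> 'I_C) (psi : 'I_C -> T * bool).
Hypotheses (phiK : cancel phi psi) (psiK : cancel psi phi).

Definition hash_of (om : sample n T rows) : {ffun 'I_rows -> {ffun 'I_n -> 'I_C}} :=
  [ffun u => [ffun i => phi ((om u).1 i, ((om u).2 i).1 (+) ((om u).2 i).2)]].

Definition sign_of (om : sample n T rows) : {ffun 'I_rows -> {ffun 'I_n -> bool}} :=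
  [ffun u => [ffun i => ((om u).2 i).2]].

(** The encoding is a bijection, since adding the sign to the bucket parity recovers the first bit;
    it preserves the uniform law. *)
Lemma cs_prob_avg (E : {ffun 'I_rows -> {ffun 'I_n -> 'I_C}} ->
    {ffun 'I_rows -> {ffun 'I_n -> bool}} -> bool) :
  cs_prob R E = avg (fun om => (E (hash_of om) (sign_of om))%:R).
Proof.
pose h om := (hash_of om, sign_of om).
have hb : bijective h.
  exists (fun hs : {ffun 'I_rows -> {ffun 'I_n -> 'I_C}} * {ffun 'I_rows -> {ffun 'I_n ->
    bool}} =>
    [ffun u => ([ffun i => (psi (hs.1 u i)).1],
      [ffun i => ((psi (hs.1 u i)).2 (+) hs.2 u i, hs.2 u i)])] : sample n T rows).
    move=> om; apply/ffunP => u; rewrite ffunE; case E1 : (om u) => [th w].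
    congr (_, _); apply/ffunP => i; rewrite !ffunE E1 /= phiK //=.
    by rewrite -addbA addbb addbF; case: (w i).
  case=> hh ss; congr (_, _); apply/ffunP => u; apply/ffunP => i; rewrite !ffunE //=.
  by rewrite -addbA addbb addbF -surjective_pairing psiK.
rewrite -(avg_bij (fun hs => (E hs.1 hs.2)%:R) hb) /cs_prob /avg; congr (_ / _).
rewrite -sum1_card natr_sum big_mkcond; apply: eq_bigr => hs _.
by rewrite inE; case: (E _ _).
Qed.

Variable x : 'I_n -> R.

Lemma estimate_row_err (om : sample n T rows) u i :
  sgn R (sign_of om u i) * cs_sketch (hash_of om) (sign_of om) x u (hash_of om u i) =
  x i + row_err x (om u).1 (om u).2 i.
Proof.
rewrite /cs_sketch (bigD1 i) //= mulrDr; congr (_ + _).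
  by rewrite mulrA /sgn; case: ifP => _; rewrite ?mulrNN !mul1r.
rewrite mulr_sumr /row_err /pair_err big_mkcond [RHS]big_mkcond; apply: eq_bigr => j _.
rewrite !ffunE (inj_eq (can_inj phiK)) andbC xpair_eqE.
case: (j != i) => //=; case: ((om u).1 j == _) => //=.
case: ((om u).2 j) ((om u).2 i) => [[] []] [[] []] /=; rewrite /sgn /=; lra.
Qed.

Lemma far_of_error (om : sample n T rows) tau i : (0 < rows)%N ->
  tau < `|cs_estimate (hash_of om) (sign_of om) x i - x i| -> far x tau om i.
Proof.
move=> r0; rewrite ltr_normr /cs_estimate; set s := [seq _ | u <- _].
have ss : size s = rows by rewrite size_map size_enum_ord.
have cnt (P : pred R) : count P s =
    #|[pred u : 'I_rows | P (x i + row_err x (om u).1 (om u).2 i)]|.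
  rewrite count_map -sum1_count -sum1_card big_enum_cond /=; apply: eq_bigl => u.
  by rewrite /= estimate_row_err.
case/orP => e; apply/existsP.
  exists true; rewrite -{1}ss; apply: leq_trans (median_gt (v := x i + tau) _ _) _.
  - by rewrite ss.
  - by lra.
  rewrite cnt leq_mul2l /=; apply/subset_leq_card/fintype.subsetP => u.
  by rewrite !inE /hit /sgn ltrD2l mul1r.
exists false; rewrite -{1}ss; apply: leq_trans (median_lt (v := x i - tau) _ _) _.
- by rewrite ss.
- by lra.
rewrite cnt leq_mul2l /=; apply/subset_leq_card/fintype.subsetP => u.
by rewrite !inE /hit /sgn ltrD2l mulN1r ltrNr.
Qed.

End Encoding.

Section Levels.
Variables (R : realType) (n k rows : nat) (T : finType) (t0 : T) (x : 'I_n -> R) (V : R).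
Hypotheses (V0 : 0 <= V) (kn : (2 * k <= n)%N) (kT : (4 * k <= #|T|)%N).
Hypothesis xV : \sum_(i < n | (k <= i)%N) x i ^+ 2 <= V * #|T|%:R.

Definition far_set (tau : R) (om : sample n T rows) : {set 'I_n} :=
  [set i : 'I_n | (i < 2 * k)%N && far x tau om i].

Lemma card_lt2k : #|[set i : 'I_n | (i < 2 * k)%N]| = (2 * k)%N.
Proof.
rewrite -sum1_card (eq_bigl (fun j : 'I_n => (j < 2 * k)%N)) => [|j]; last by rewrite inE.
by rewrite (big_ord_narrow kn) sum1_card card_ord.
Qed.

Lemma avg_far (rho : R) (i : 'I_n) : 0 < rho <= 1 ->
  320 * (1 + expR 1) <= #|T|%:R :> R ->
  avg (fun om : sample n T rows => (far x (rho * Num.sqrt V) om i)%:R) <=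
  2 * expR (- (rho ^+ 2 * rows%:R / (800 * 160))).
Proof.
move=> r01 T1; have kn' : (k <= n)%N by lia.
have r2 : 1%:R * rho ^+ 2 <= 1.
  by case/andP: r01 => r0 r1; rewrite mul1r expr_le1 // ltW.
have T1' : 320 * (1%:R ^+ 2 * (1 + 1%:R * expR 1%:R)) <= #|T|%:R :> R.
  by rewrite expr1n !mul1r.
have inj1 : injective (fun _ : 'I_1 => i) by move=> r r' _; rewrite !ord1.
have := tuple_tail t0 V0 kn' kT xV rows inj1 r01 r2 T1'.
rewrite mul1r expr1; apply: le_trans; apply: le_avg => om; rewrite ler_nat.
case: (boolP (far _ _ _ _)) => //= fi.
by rewrite lt0b; apply/forallP.
Qed.

(* First moment of the number of injective m-tuples of far coordinates. *)
Lemma avg_far_set (m : nat) (rho z : R) : 0 < rho <= 1 -> m%:R * rho ^+ 2 <= 1 ->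
  320 * (m%:R ^+ 2 * (1 + m%:R * expR m%:R)) <= #|T|%:R :> R ->
  0 < z -> 2 * m%:R <= z ->
  avg (fun om : sample n T rows => (z < #|far_set (rho * Num.sqrt V) om|%:R)%R%:R) <=
  (8 * k%:R / z) ^+ m * expR (- (m%:R * rho ^+ 2 * rows%:R / (800 * 160))).
Proof.
move=> r01 mr mT z0 mz; set e := expR (- _); set tau := rho * _.
have kn' : (k <= n)%N by lia.
pose H := [set i : 'I_n | (i < 2 * k)%N].
pose I (f : {ffun 'I_m -> 'I_n}) := (f \in ffun_on H) && injectiveb f.
(* As 2 m <= z, every factor of the falling factorial of a set size above z is at least z - m >= z /
   2. *)
have falling (om : sample n T rows) : (z / 2) ^+ m * (z < #|far_set tau om|%:R)%R%:R <=
    \sum_(f : {ffun 'I_m -> 'I_n} | I f) [forall r, far x tau om (f r)]%:R.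
  have -> : \sum_(f : {ffun 'I_m -> 'I_n} | I f) [forall r, far x tau om (f r)]%:R =
      (#|far_set tau om| ^_ m)%:R :> R.
    have <- : #|[set f : {ffun 'I_m -> 'I_n} in ffun_on (far_set tau om) | injectiveb f]| =
        (#|far_set tau om| ^_ m)%N.
      by rewrite -[in RHS](card_ord m) -(card_inj_ffuns_on _ (mem (far_set tau om))).
    rewrite -sum1_card natr_sum big_mkcond [RHS]big_mkcond; apply: eq_bigr => f _.
    rewrite inE /I; case: (boolP (injectiveb f)) => finj; rewrite ?andbF ?andbT //.
    case: (boolP (f \in ffun_on H)) => [/ffun_onP fH|fH].
      case: (boolP [forall r, _]) => [/forallP far1|nfar].
        suff -> : f \in ffun_on (far_set tau om) by [].
        by apply/ffun_onP => r; have := fH r; rewrite !inE far1 andbT.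
      case: (boolP (_ \in _)) => // /ffun_onP h; case/negP: nfar; apply/forallP => r.
      by have := h r; rewrite inE => /andP[].
    case: (boolP (_ \in _)) => // /ffun_onP h; case/negP: fH; apply/ffun_onP => r.
    by have := h r; rewrite !inE => /andP[].
  have [|_] := ltP z; last by rewrite mulr0.
  rewrite mulr1; set N := #|_| => zN; rewrite ffact_prod natr_prod.
  have -> : (z / 2) ^+ m = \prod_(i < m) (z / 2) by rewrite prodr_const card_ord.
  apply: ler_prod => i _; rewrite divr_ge0 ?ltW //=.
  have im : (i%:R : R) <= m%:R by rewrite ler_nat ltnW.
  rewrite natrB; first by lra.
  by rewrite -(ler_nat R); lra.
(* Per coordinate: 2k choices, two sides, and the factor 2 from z / 2 make up 8 k / z. *)
have : (z / 2) ^+ m * avg (fun om : sample n T rows => (z < #|far_set tau om|%:R)%R%:R) <= (2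
  * k%:R) ^+ m * (2 ^+ m * e).
  rewrite -avgZ; apply: le_trans (le_avg falling) _; rewrite avg_sum.
  apply: (@le_trans _ _ (\sum_(f : {ffun 'I_m -> 'I_n} | I f) 2 ^+ m * e)).
    apply: ler_sum => f /andP[_ /injectiveP finj].
    exact: (tuple_tail t0 V0 kn' kT xV).
  rewrite sumr_const -[_ *+ _]mulr_natl ler_wpM2r ?mulr_ge0 ?exprn_ge0 ?expR_ge0 //.
  have -> : #|[pred f | I f]| = ((2 * k) ^_ m)%N.
    rewrite -card_lt2k -[in RHS](card_ord m) -(card_inj_ffuns_on _ (mem H)).
    by apply: eq_card => f; rewrite !inE.
  rewrite -natrM -natrX ler_nat ffact_prod.
  apply: (@leq_trans (\prod_(i < m) (2 * k))); last by rewrite prod_nat_const card_ord.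
  by apply: leq_prod => i _; exact: leq_subr.
rewrite mulrC -ler_pdivlMr ?exprn_gt0 ?divr_gt0 // => /le_trans; apply.
rewrite le_eqVlt; apply/orP; left; apply/eqP.
rewrite mulrA -exprMn mulrAC -expr_div_n; congr (_ ^+ _ * _); field; lra.
Qed.

End Levels.

(** Induction on the layers: if [q] exceeds the new threshold, the decrement makes up for lowering
    [t M]; otherwise the new threshold alone bounds [q]. *)
Lemma layer_bound (R : realType) (t : nat -> R) (q : R) (M : nat) :
  (forall m, t m.+1 <= t m) -> q <= t 0%N ->
  q <= t M + \sum_(m < M) (t m - t m.+1) * (t m.+1 < q)%R%:R.
Proof.
move=> td q0; elim: M => [|M IH]; first by rewrite big_ord0 addr0.
rewrite big_ord_recr /=; have [_|qM] := ltP (t M.+1) q; first by rewrite mulr1; lra.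
rewrite mulr0 addr0; apply: le_trans qM _; rewrite lerDl.
by apply: sumr_ge0 => m _; rewrite mulr_ge0 // subr_ge0.
Qed.

Lemma exprn_le_expR (R : realType) (y : R) (m : nat) : 0 <= y -> (0 < m)%N ->
  (1 + y / m%:R) ^+ m <= expR y.
Proof.
move=> y0 m0; have mn0 : m%:R != 0 :> R by rewrite pnatr_eq0 -lt0n.
rewrite -[in leRHS](divfK mn0 y) [_ * m%:R]mulrC expRM_natl.
by rewrite lerXn2r ?nnegrE ?expR_ge0 ?expR_ge1Dx // addr_ge0 // divr_ge0.
Qed.

Lemma natr_exists_le (R : realType) (I : finType) (P : pred I) :
  [exists i, P i]%:R <= \sum_i (P i)%:R :> R.
Proof.
case: (boolP [exists i, P i]) => [/existsP[i Pi]|_]; last by apply: sumr_ge0.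
by rewrite (bigD1 i) //= Pi lerDl sumr_ge0.
Qed.

(** * Failure events and the squared error over all scales *)

Section Failure.
Variables (R : realType) (n k rows : nat) (T : finType) (t0 : T) (x : 'I_n -> R) (V : R).
Hypotheses (V0 : 0 <= V) (k0 : (0 < k)%N) (kn : (2 * k <= n)%N) (kT : (4 * k <= #|T|)%N).
Hypothesis xV : \sum_(i < n | (k <= i)%N) x i ^+ 2 <= V * #|T|%:R.
Hypothesis rows0 : (0 < rows)%N.
Variables (L : nat) (w g : R).
Let M : R := L.+1%:R.
Hypotheses (w0 : 0 < w) (wrows : w <= rows%:R) (g8 : 8 <= g).
Hypothesis wg : w / (800 * 160) = 2 * g * M.
Hypotheses (MT : 320 * (M ^+ 2 * (1 + M * expR M)) <= #|T|%:R) (Mk : 2 * M ^+ 2 <= k%:R).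

(** Chosen so that m rho^2 rows = [w]: every level has the same tail exponent. *)
Definition level (m : nat) : R := Num.sqrt (w / m%:R / rows%:R).
(** Quadratic growth balances layer decrements of order 1 / m^2; by [Mk] the quota is at least 2m,
    as counting m-tuples requires. *)
Definition quota (m : nat) : R := k%:R * m%:R ^+ 2 / M ^+ 2.

(** The events concern, in turn, the uniform bound that confines the top k, the first layer of the
    squared error sum, and the later layers. *)
Definition bad (om : sample n T rows) : bool :=
  [|| [exists i, far x (1 * Num.sqrt V) om i],
      [exists i : 'I_n, (i < 2 * k)%N && far x (level 1 * Num.sqrt V) om i] |
      [exists m : 'I_L.+1, quota m.+1 < #|far_set k x (level m.+1 * Num.sqrt V) om|%:R]].

Lemma rowsR0 : 0 < rows%:R :> R. Proof. by rewrite ltr0n. Qed.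

Lemma M_ge1 : 1 <= M. Proof. by rewrite /M ler1n. Qed.

Lemma level_sqr m : (0 < m)%N -> level m ^+ 2 = w / m%:R / rows%:R.
Proof. by move=> m0; rewrite sqr_sqrtr // !divr_ge0 // ltW. Qed.

Lemma level_gt0 m : (0 < m)%N -> 0 < level m.
Proof. by move=> m0; rewrite sqrtr_gt0 !divr_gt0 ?ltr0n. Qed.

Lemma level01 m : (0 < m)%N -> 0 < level m <= 1.
Proof.
move=> m0; rewrite level_gt0 //= -(@ler_pXn2r _ 2) ?nnegrE ?(ltW (level_gt0 m0)) //.
rewrite level_sqr // expr1n ler_pdivrMr ?rowsR0 // mul1r; apply: le_trans wrows.
by rewrite ler_pdivrMr ?ltr0n // ler_peMr ?ler1n // ltW.
Qed.

Lemma MT_le m : (0 < m <= L.+1)%N ->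
  320 * (m%:R ^+ 2 * (1 + m%:R * expR m%:R)) <= #|T|%:R :> R.
Proof.
case/andP=> m0 mL; have mM : m%:R <= M :> R by rewrite ler_nat.
have m0' : 0 <= m%:R :> R by [].
have M0 : 0 <= M by apply: le_trans mM.
apply: le_trans MT; apply: ler_wpM2l; first by lra.
apply: ler_pM; rewrite ?sqr_ge0 ?addr_ge0 ?mulr_ge0 ?expR_ge0 //.
  by rewrite lerXn2r ?nnegrE.
by rewrite lerD2l ler_pM ?expR_ge0 ?ler_expR.
Qed.

(** Counting tuples costs (8 (M/m)^2)^m, at most e^(g M) because 8 y^2 <= e^(8 y); this uses up half
    of the exponent 2 g M. *)
Lemma avg_level m : (0 < m <= L.+1)%N ->
  avg (fun om : sample n T rows =>
    (quota m < #|far_set k x (level m * Num.sqrt V) om|%:R)%R%:R) <= expR (- (g * M)).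
Proof.
move=> mL; have /andP[m0 mL'] := mL.
have mp : 0 < m%:R :> R by rewrite ltr0n.
have mM : m%:R <= M :> R by rewrite ler_nat.
have M1 := M_ge1; have r0 := rowsR0.
have M0 : 0 < M by lra.
have kp : 0 < k%:R :> R by rewrite ltr0n.
have mlev : m%:R * level m ^+ 2 = w / rows%:R.
  by rewrite level_sqr //; field; rewrite !gt_eqF.
have q0 : 0 < quota m by rewrite /quota divr_gt0 ?mulr_gt0 ?exprn_gt0.
have q2 : 2 * m%:R <= quota m.
  rewrite /quota ler_pdivlMr ?(exprn_gt0 _ M0) //.
  have m1 : 1 <= m%:R :> R by rewrite ler1n.
  have a : 0 <= (k%:R - 2 * M ^+ 2) * m%:R ^+ 2 by rewrite mulr_ge0 ?sqr_ge0 // subr_ge0.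
  have b : 0 <= 2 * M ^+ 2 * m%:R * (m%:R - 1).
    by rewrite !mulr_ge0 ?sqr_ge0 // subr_ge0.
  by lra.
apply: le_trans (avg_far_set rows t0 V0 kn kT xV (level01 m0) _ (MT_le mL) q0 q2) _.
  by rewrite mlev ler_pdivrMr // mul1r.
rewrite mlev divfK ?gt_eqF // wg.
have -> : 8 * k%:R / quota m = 8 * (M / m%:R) ^+ 2.
  by rewrite /quota; field; rewrite !gt_eqF //; lra.
have -> : expR (- (g * M)) = expR (g * (M / m%:R)) ^+ m * expR (- (2 * g * M)).
  rewrite -expRM_natl -expRD; congr expR; field; rewrite gt_eqF //.
rewrite ler_wpM2r ?expR_ge0 // lerXn2r ?nnegrE ?mulr_ge0 ?sqr_ge0 ?expR_ge0 //.
have y1 : 1 <= M / m%:R by rewrite ler_pdivlMr ?mul1r.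
set y := M / m%:R in y1 *.
apply: (@le_trans _ _ (expR (8 * y))); last by rewrite ler_expR ler_wpM2r //; lra.
apply: le_trans (exprn_le_expR (m := 2) _ _) => //; last by lra.
by nra.
Qed.

(** Union bound: the uniform event gives the term in [n], the 2k coordinates at level 1 give 4k, and
    the M levels at most another k by [Mk]. *)
Lemma avg_bad :
  avg (fun om => (bad om)%:R) <=
  2 * n%:R * expR (- (rows%:R / (800 * 160))) + 5 * k%:R * expR (- (g * M)).
Proof.
have M1 := M_ge1; have g8' := g8.
have T1 : 320 * (1 + expR 1) <= #|T|%:R :> R.
  have := @MT_le 1 isT; by rewrite expr1n !mul1r.
apply: (@le_trans _ _ (\sum_(i < n) avg (fun om : sample n T rows => (far x (1 * Num.sqrt V)
  om i)%:R) +
   (\sum_(i < n | (i < 2 * k)%N) avg (fun om : sample n T rows => (far x (level 1 * Num.sqrt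
     V) om i)%:R) +
    \sum_(m < L.+1) avg (fun om : sample n T rows =>
      (quota m.+1 < #|far_set k x (level m.+1 * Num.sqrt V) om|%:R)%R%:R)))).
  rewrite -!avg_sum -!avgD; apply: le_avg => om; rewrite /bad.
  have orb_le (a b : bool) : (a || b)%:R <= a%:R + b%:R :> R by case: a; case: b; rewrite /=;
    lra.
  apply: le_trans (orb_le _ _) _; apply: lerD; first exact: natr_exists_le.
  apply: le_trans (orb_le _ _) _; apply: lerD; last exact: natr_exists_le.
  apply: le_trans (natr_exists_le _ _) _; rewrite [leRHS]big_mkcond.
  by apply: ler_sum => i _; case: ifP.
have h1 : \sum_(i < n) avg (fun om : sample n T rows => (far x (1 * Num.sqrt V) om i)%:R) <=
    2 * n%:R * expR (- (rows%:R / (800 * 160))) :> R.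
  apply: (@le_trans _ _ (\sum_(i < n) (2 * expR (- (rows%:R / (800 * 160))) : R))).
    apply: ler_sum => i _; have := avg_far (rho := 1) rows t0 V0 kn kT xV i _ T1.
    by rewrite expr1n [1 * rows%:R]mul1r; apply; rewrite ltr01 lexx.
  by rewrite sumr_const card_ord -[_ *+ n]mulr_natl mulrA [n%:R * 2]mulrC.
have h2 : \sum_(i < n | (i < 2 * k)%N)
    avg (fun om : sample n T rows => (far x (level 1 * Num.sqrt V) om i)%:R) <=
    4 * k%:R * expR (- (g * M)).
  apply: (@le_trans _ _ (\sum_(i < n | (i < 2 * k)%N) 2 * expR (- (g * M)))).
    apply: ler_sum => i _; apply: le_trans (avg_far rows t0 V0 kn kT xV i (level01 _) T1) _ =>
      //.
    rewrite level_sqr // divr1 divfK ?gt_eqF ?rowsR0 // wg ler_wpM2l // ler_expR lerN2.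
    by nra.
  rewrite (big_ord_narrow kn) sumr_const card_ord -[_ *+ (2 * k)]mulr_natl natrM.
  by rewrite le_eqVlt; apply/orP; left; apply/eqP; ring.
have h3 : \sum_(m < L.+1) avg (fun om : sample n T rows =>
      (quota m.+1 < #|far_set k x (level m.+1 * Num.sqrt V) om|%:R)%R%:R) <=
    k%:R * expR (- (g * M)).
  apply: (@le_trans _ _ (\sum_(m < L.+1) expR (- (g * M)))).
    by apply: ler_sum => m _; apply: avg_level; rewrite /= ltn_ord.
  rewrite sumr_const card_ord -[_ *+ L.+1]mulr_natl ler_wpM2r ?expR_ge0 //.
  by have := Mk; rewrite -/M; nra.
by lra.
Qed.

(** Layers at U / m, with U = w V / rows: by the quotas each of fewer than M layers costs at most 2
    U k / M^2, and the remainder U / M is paid by 2k coordinates. Each part is at most 2 k U / M. *)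
Lemma sum_sqr_error (om : sample n T rows) (e : 'I_n -> R) :
  (forall tau i, tau < `|e i| -> far x tau om i) -> ~~ bad om ->
  \sum_(i < n | (i < 2 * k)%N) e i ^+ 2 <= 4 * k%:R * (w / M) * V / rows%:R.
Proof.
move=> efar; rewrite /bad !negb_or => /and3P[_ /existsPn small /existsPn few].
have r0 := rowsR0; have M1 := M_ge1.
have kp : 0 < k%:R :> R by rewrite ltr0n.
set U := w * V / rows%:R.
have U0 : 0 <= U by rewrite divr_ge0 ?mulr_ge0 // ltW.
have C0 : 0 <= U * k%:R / M ^+ 2.
  by apply: divr_ge0; rewrite ?sqr_ge0 //; apply: mulr_ge0 => //; rewrite ltW.
have lev_sqr m : (0 < m)%N -> (level m * Num.sqrt V) ^+ 2 = U / m%:R.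
  move=> m0; rewrite exprMn level_sqr // sqr_sqrtr // /U; field.
  by rewrite !gt_eqF ?ltr0n.
have lev0 m : (0 < m)%N -> 0 <= level m * Num.sqrt V.
  by move=> m0; rewrite mulr_ge0 ?sqrtr_ge0 // ltW ?level_gt0.
have lev_far m i : (0 < m)%N -> ~~ far x (level m * Num.sqrt V) om i -> e i ^+ 2 <= U / m%:R.
  move=> m0 nf; rewrite -lev_sqr // -real_normK ?num_real // lerXn2r ?nnegrE ?lev0 //.
  by rewrite leNgt; apply: contra nf; exact: efar.
pose t m : R := U / m.+1%:R.
have td m : t m.+1 <= t m.
  by rewrite /t ler_wpM2l // lef_pV2 ?posrE ?ltr0n // ler_nat.
apply: (@le_trans _ _ (\sum_(i < n | (i < 2 * k)%N)
    (t L + \sum_(m < L) (t m - t m.+1) * (t m.+1 < e i ^+ 2)%R%:R))).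
  apply: ler_sum => i ik; apply: layer_bound => //.
  by rewrite /t; apply: lev_far => //; have := small i; rewrite ik.
rewrite big_split /= exchange_big /=.
rewrite (big_ord_narrow kn) sumr_const card_ord -[_ *+ (2 * k)]mulr_natl natrM.
have step (m : 'I_L) : \sum_(i < n | (i < 2 * k)%N) (t m - t m.+1) * (t m.+1 < e i ^+ 2)%R%:R <=
    2 * U * k%:R / M ^+ 2.
  rewrite -mulr_sumr.
  apply: (@le_trans _ _ ((t m - t m.+1) * quota m.+2)).
    rewrite ler_wpM2l ?subr_ge0 //.
    have mL : (m.+1 < L.+1)%N by rewrite ltnS.
    have := few (Ordinal mL); rewrite /= -leNgt; apply: le_trans.
    rewrite -sum1_card natr_sum big_mkcond [leRHS]big_mkcond; apply: ler_sum => i _.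
    rewrite inE; case: ifP => //= ik; case: ltP => [lt|_] /=; last by case: ifP.
    case: ifP => // /negbT /(lev_far m.+2 i isT); rewrite leNgt.
    by move: lt; rewrite /t => ->.
  (* With y = m + 1, the decrement U / (y (y + 1)) times the quota k (y + 1)^2 / M^2 is 1 + 1/y <= 2
     times U k / M^2. *)
  rewrite /t /quota -[m.+2%:R]natr1.
  have : 1 <= m.+1%:R :> R by rewrite ler1n.
  move: m.+1%:R => y y1.
  have -> : (U / y - U / (y + 1)) * (k%:R * (y + 1) ^+ 2 / M ^+ 2) =
      (U * k%:R / M ^+ 2) * (1 + 1 / y).
    by field; rewrite !gt_eqF //; lra.
  have -> : 2 * U * k%:R / M ^+ 2 = (U * k%:R / M ^+ 2) * 2 by ring.
  apply: (ler_wpM2l C0).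
  have : 1 / y <= 1 by rewrite ler_pdivrMr; lra.
  by lra.
have : \sum_(m < L) \sum_(i < n | (i < 2 * k)%N) (t m - t m.+1) * (t m.+1 < e i ^+ 2)%R%:R <=
    L%:R * (2 * U * k%:R / M ^+ 2).
  apply: le_trans (ler_sum _ (fun m _ => step m)) _.
  by rewrite sumr_const card_ord -[_ *+ L]mulr_natl.
have : L%:R * (2 * U * k%:R / M ^+ 2) <= M * (2 * U * k%:R / M ^+ 2).
  have C2 : 0 <= 2 * U * k%:R / M ^+ 2.
    have -> : 2 * U * k%:R / M ^+ 2 = 2 * (U * k%:R / M ^+ 2) by rewrite !mulrA.
    exact: mulr_ge0.
  by apply: (ler_wpM2r C2); rewrite ler_nat.
have -> : M * (2 * U * k%:R / M ^+ 2) = 2 * k%:R * (U / M) by field; rewrite gt_eqF //; lra.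
have -> : 4 * k%:R * (w / M) * V / rows%:R = 4 * k%:R * (U / M).
  by rewrite /U; field; rewrite !gt_eqF //; lra.
move=> h1 h2; have := le_trans h2 h1; rewrite -[t L]/(U / M).
by move: (\sum_(m < L) _) (U / M) => S z; lra.
Qed.

End Failure.

(** * Numerical bounds for the constants *)

Section Constants.
Variable R : realType.

(** Reduces the size conditions on [#|T|] and [k] to e^(2M) <= k, through (1 + y/3)^3 <= e^y and (1
    + y/2)^2 <= e^y. *)
Lemma row_condition_bounds (y : R) : 1 <= y ->
  y ^+ 2 * (1 + y * expR y) <= 54 * expR (2 * y) /\ 2 * y ^+ 2 <= expR (2 * y).
Proof.
move=> y1; have E : expR (2 * y) = expR y ^+ 2 by rewrite -expRM_natl.
have e2 : (1 + y / 2) ^+ 2 <= expR y by apply: exprn_le_expR => //; lra.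
have e3 : (1 + y / 3) ^+ 3 <= expR y by apply: exprn_le_expR => //; lra.
have e0 := expR_gt0 y; rewrite E; split.
  have y3 : y ^+ 3 <= 27 * expR y.
    have -> : y ^+ 3 = 27 * (y / 3) ^+ 3 by field.
    rewrite ler_wpM2l // (le_trans _ e3) // lerXn2r ?nnegrE; lra.
  have : y ^+ 2 <= y ^+ 3 * expR y.
    have -> : y ^+ 3 * expR y = y ^+ 2 * (y * expR y) by ring.
    by rewrite ler_peMr ?sqr_ge0 //; have := expR_ge1Dx y; nra.
  have : y ^+ 3 * expR y <= 27 * expR y * expR y by rewrite ler_wpM2r // ltW.
  by lra.
have : ((1 + y / 2) ^+ 2) ^+ 2 <= expR y ^+ 2.
  by rewrite lerXn2r ?nnegrE ?sqr_ge0 // ltW.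
apply: le_trans.
have : 0 <= y * (y - 1) ^+ 2 by rewrite mulr_ge0 ?sqr_ge0 //; lra.
have : 0 <= y ^+ 4 by rewrite exprn_ge0 //; lra.
have := sqr_ge0 y.
by lra.
Qed.

Lemma vatE (n : nat) (x : 'I_n -> R) (j : nat) (jn : (j < n)%N) : vat x j = x (Ordinal jn).
Proof. by rewrite /vat insubT. Qed.

(** As M > ln k / 2 - 1, the exponent g M is at least (d + 1) ln k - g: one power of k absorbs the
    factor k, and rounding costs e^g. *)
Lemma failure_rate (d : R) (n k rows M : nat) (g := 2 * (d + 1) + 8) :
  0 < d -> (0 < k)%N -> (2 * k <= n)%N ->
  2 * g * (800 * 160) * ln (n%:R : R) <= rows%:R -> ln (k%:R : R) / 2 < M%:R + 1 ->
  2 * n%:R * expR (- (rows%:R / (800 * 160))) + 5 * k%:R * expR (- (g * M%:R)) <=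
  (2 + 5 * expR g) / powR (k%:R : R) d.
Proof.
move=> d0 k0 kn rn Mk; have kp : 0 < k%:R :> R by rewrite ltr0n.
have n0 : (0 < n)%N by lia.
have np : 0 < n%:R :> R by rewrite ltr0n.
rewrite /powR gt_eqF // -expRN.
set lk := ln k%:R in Mk *; set ln_n := ln n%:R in rn.
have lk0 : 0 <= lk by rewrite ln_ge0 // ler1n.
have lkn : lk <= ln_n by rewrite ler_ln ?posrE // ler_nat (leq_trans _ kn) // leq_pmull.
have h1 : n%:R * expR (- (rows%:R / (800 * 160))) <= expR (- (d * lk)).
  rewrite -{1}[n%:R]lnK ?posrE // -/ln_n -expRD ler_expR.
  have : 2 * g * ln_n <= rows%:R / (800 * 160) by rewrite ler_pdivlMr; lra.
  have : d * lk <= d * ln_n by rewrite ler_wpM2l // ltW.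
  have : 0 <= d * ln_n by rewrite mulr_ge0 ?(ltW d0) // (le_trans lk0).
  have := le_trans lk0 lkn; rewrite /g; lra.
have h2 : k%:R * expR (- (g * M%:R)) <= expR g * expR (- (d * lk)).
  rewrite -{1}[k%:R]lnK ?posrE // -/lk -!expRD ler_expR.
  have : g * (lk / 2) <= g * (M%:R + 1) by rewrite ler_wpM2l ?ltW // /g; lra.
  by rewrite /g; nra.
by lra.
Qed.

End Constants.

(** * Use of the gap hypothesis *)

Section Gap.
Variables (R : realType) (n k rows : nat) (x xhat : 'I_n -> R) (a B : R) (D : nat).
Hypotheses (a0 : 0 < a) (k0 : (0 < k)%N) (kn : (2 * k <= n)%N) (D0 : (0 < D)%N).
Hypothesis aD : 9 * k%:R <= a ^+ 2 * D%:R.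
Hypothesis xsorted : forall i j : 'I_n, (i <= j)%N -> `|x j| <= `|x i|.
Hypothesis xgap : a * tail_norm k x / Num.sqrt (k%:R : R) <= `|vat x k.-1| - `|vat x (2 *
  k).-1|.
Let V : R := tail_norm k x ^+ 2 / D%:R.

(** By [aD] the gap is at least 3 sqrt V, strictly more than the 2 sqrt V asked by [Ek_le] if the
    tail is nonzero; a zero tail makes the estimate exact. *)
Lemma Ek_le_of_close :
  (forall i, `|xhat i - x i| <= Num.sqrt V) ->
  Ek k x xhat ^+ 2 <= \sum_(i < n | (i < 2 * k)%N) (xhat i - x i) ^+ 2.
Proof.
move=> close; have gap := xgap; set t := tail_norm k x in gap *.
have t0 : 0 <= t by rewrite sqrtr_ge0.
have Dp : 0 < D%:R :> R by rewrite ltr0n.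
have kp : 0 < k%:R :> R by rewrite ltr0n.
have V0 : 0 <= V by rewrite divr_ge0 ?sqr_ge0.
have [tt|tn] := eqVneq t 0.
  rewrite Ek_self; first by apply: sumr_ge0 => i _; exact: sqr_ge0.
  move=> i; apply/eqP; rewrite -subr_eq0 -normr_le0; apply: le_trans (close i) _.
  by rewrite /V -/t tt expr0n mul0r sqrtr0.
have tp : 0 < t by rewrite lt_neqAle eq_sym tn.
have sV : 0 < Num.sqrt V by rewrite sqrtr_gt0 divr_gt0 ?exprn_gt0.
have h3 : 3 * Num.sqrt V <= a * t / Num.sqrt k%:R.
  rewrite -(@ler_pXn2r _ 2) ?nnegrE ?mulr_ge0 ?invr_ge0 ?sqrtr_ge0 ?(ltW a0) //.
  rewrite expr_div_n !exprMn (sqr_sqrtr V0) (sqr_sqrtr (ler0n R k)) /V -/t.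
  rewrite mulrA ler_pdivrMr // [leRHS]mulrAC ler_pdivlMr //.
  have -> : 3 ^+ 2 * t ^+ 2 * k%:R = (9 * k%:R) * t ^+ 2 :> R by ring.
  have -> : a ^+ 2 * t ^+ 2 * D%:R = (a ^+ 2 * D%:R) * t ^+ 2 by ring.
  by rewrite ler_wpM2r ?sqr_ge0.
apply: (Ek_le kn (g := Num.sqrt V)) => // i j ik jk.
have k1 : (k.-1 < n)%N by rewrite prednK // (leq_trans _ kn) // leq_pmull.
have k2 : ((2 * k).-1 < n)%N by rewrite prednK // muln_gt0.
move: gap; rewrite (vatE x k1) (vatE x k2).
have xi : `|x i| <= `|x (Ordinal k2)| by apply: xsorted; rewrite /= (leq_trans (leq_pred _)).
have xj : `|x (Ordinal k1)| <= `|x j| by apply: xsorted; rewrite /= -ltnS prednK.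
by lra.
Qed.

End Gap.

(** * Choice of constants and conclusion *)

Theorem theorem7p1 (R : realType) (a d : R) (ha : 0 < a) (hd : 0 < d) :
  exists (b : R) (c : nat) (K : R), 0 < b /\ (0 < c)%N /\ 0 < K /\
  forall (n k : nat) (x : 'I_n -> R),
    (0 < k)%N -> (2 * k <= n)%N ->
    (forall i j : 'I_n, (i <= j)%N -> `|x j| <= `|x i|) ->
    a * tail_norm k x / Num.sqrt (k%:R : R) <= `|vat x k.-1| - `|vat x (2 * k).-1| ->
    forall rows : nat, b * ln (n%:R : R) <= (rows%:R : R) ->
    1 - K / powR (k%:R : R) d <=
    @cs_prob R n rows (c * k) (fun h s =>
       Ek k x (@cs_estimate R n rows (c * k) h s x) ^+ 2
         <= (rows%:R : R)^-1 * tail_norm k x ^+ 2).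
Proof.
pose g : R := 2 * (d + 1) + 8; pose t1 : R := 2 * g * (800 * 160).
have g8 : 8 <= g by rewrite /g; lra.
have t10 : 0 < t1 by rewrite /t1; lra.
have a2 : 0 <= 9 / a ^+ 2 by rewrite divr_ge0 ?sqr_ge0.
(* The summands serve the final comparison with the squared tail norm, the gap condition 9 k <= a^2
   D, and the size condition of [row_mgf]. *)
have [c' c'gt] : exists c' : nat, 4 * t1 + 9 / a ^+ 2 + 320 * 54 <= c'%:R :> R.
  by exists (Num.truncn (4 * t1 + 9 / a ^+ 2 + 320 * 54)).+1; apply: ltW; apply: truncnS_gt.
have c'0 : (0 < c')%N by rewrite -(ltr_nat R); lra.
(* Each element of [T] stands for a pair of buckets, hence the factor 2. *)
exists t1, (2 * c')%N, (2 + 5 * expR g); split; first by [].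
split; first by rewrite muln_gt0.
split; first by have := expR_gt0 g; lra.
move=> n k x k0 kn xsorted xgap rows hrows.
have kp : 0 < k%:R :> R by rewrite ltr0n.
have rows0 : (0 < rows)%N.
  rewrite -(ltr_nat R); apply: lt_le_trans hrows; rewrite mulr_gt0 // ln_gt0 // ltr1n.
  by rewrite (leq_trans _ kn) // -[X in (X < _)%N]/(2 * 1).-1 prednK ?leq_mul2l.
have rp : 0 < rows%:R :> R by rewrite ltr0n.
set M := Num.truncn (ln k%:R / 2 : R).
have lk0 : 0 <= ln k%:R / 2 :> R by rewrite divr_ge0 // ln_ge0 // ler1n.
have /andP[Mle Mgt] := truncn_itv lk0; rewrite -/M -[M.+1%:R]natr1 in Mle Mgt.
have prob0 E : 0 <= cs_prob R (n := n) (rows := rows) (C := (2 * c' * k)%N) E.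
  by rewrite divr_ge0.
have rate := failure_rate hd k0 kn hrows Mgt.
(* For [M] = 0 the claim is vacuous: [rate] shows that the allowed failure probability is at least 5
   k. *)
case EM : M => [|L].
  apply: le_trans (prob0 _); rewrite subr_le0; apply: le_trans rate.
  rewrite EM mulr0 oppr0 expR0 mulr1.
  have : 0 <= 2 * n%:R * expR (- (rows%:R / (800 * 160))) :> R.
    by apply: mulr_ge0; [apply: mulr_ge0 | exact: expR_ge0].
  have : 1 <= k%:R :> R by rewrite ler1n.
  by lra.
pose D := (c' * k)%N; pose T : finType := 'I_D.
have D0 : (0 < D)%N by rewrite muln_gt0 c'0 k0.
have t0 : T by exact: (Ordinal D0).
have cT : #|{: T * bool}| = (2 * c' * k)%N by rewrite card_prod card_bool card_ord mulnC mulnA.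
pose phi (p : T * bool) : 'I_(2 * c' * k) := cast_ord cT (enum_rank p).
pose psi (v : 'I_(2 * c' * k)) : T * bool := enum_val (cast_ord (esym cT) v).
have phiK : cancel phi psi by move=> p; rewrite /psi /phi cast_ordK enum_rankK.
have psiK : cancel psi phi by move=> v; rewrite /psi /phi enum_valK cast_ordKV.
set t := tail_norm k x in xgap *.
pose V := t ^+ 2 / D%:R.
have Dp : 0 < D%:R :> R by rewrite ltr0n.
have DE : D%:R = c'%:R * k%:R :> R by rewrite natrM.
have V0 : 0 <= V by rewrite divr_ge0 ?sqr_ge0.
have cT4 : (4 * k <= #|T|)%N.
  by rewrite card_ord -(ler_nat R) natrM DE ler_wpM2r //; lra.
have xV : \sum_(i < n | (k <= i)%N) x i ^+ 2 <= V * #|T|%:R.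
  rewrite card_ord divfK ?gt_eqF // sqr_sqrtr // sumr_ge0 // => i _.
  exact: sqr_ge0.
pose w := t1 * L.+1%:R.
have w0 : 0 < w by rewrite mulr_gt0.
have ML : L.+1%:R <= ln k%:R / 2 :> R by rewrite -EM.
have wrows : w <= rows%:R.
  apply: le_trans hrows; rewrite ler_pM2l //; apply: (le_trans ML).
  have : ln k%:R <= ln n%:R :> R.
    by rewrite ler_ln ?posrE ?ltr0n ?ler_nat ?(leq_trans _ kn) ?leq_pmull // muln_gt0.
  by lra.
have wg : w / (800 * 160) = 2 * g * L.+1%:R by rewrite /w /t1; field.
have M1 : 1 <= L.+1%:R :> R by rewrite ler1n.
have [b1 b2] := row_condition_bounds M1.
have ek : expR (2 * L.+1%:R) <= k%:R :> R.
  by rewrite -[leRHS]lnK ?posrE // ler_expR; lra.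
have MT : 320 * (L.+1%:R ^+ 2 * (1 + L.+1%:R * expR L.+1%:R)) <= #|T|%:R :> R.
  rewrite card_ord DE; apply: (@le_trans _ _ (320 * 54 * k%:R)); first by lra.
  by rewrite ler_wpM2r //; lra.
have Mk : 2 * L.+1%:R ^+ 2 <= k%:R :> R := le_trans b2 ek.
have bad_le := avg_bad t0 V0 k0 kn cT4 xV rows0 w0 wrows g8 wg MT Mk.
rewrite (cs_prob_avg R phiK psiK).
apply: (@le_trans _ _ (1 - avg (fun om => (bad k x V L w om)%:R : R))).
  by rewrite lerB //; apply: le_trans bad_le _; rewrite -EM.
have om0 : sample n T rows := [ffun=> ([ffun=> t0], [ffun=> (true, true)])].
rewrite -{1}(avg_cst om0 1) -avgN -avgD; apply: le_avg => om.
have [bom|nbom] := boolP (bad k x V L w om); first by rewrite subrr.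
rewrite subr0; set est := cs_estimate _ _ _.
have efar tau i : tau < `|est i - x i| -> far x tau om i by exact: far_of_error.
suff -> : Ek k x est ^+ 2 <= rows%:R^-1 * t ^+ 2 by [].
apply: le_trans (Ek_le_of_close (a := a) (D := D) ha k0 kn D0 _ xsorted xgap _) _.
- have : 9 <= a ^+ 2 * c'%:R.
    by rewrite mulrC -ler_pdivrMr ?exprn_gt0 //; lra.
  by rewrite DE mulrA; move/(ler_wpM2r (ltW kp)).
- move=> i; rewrite leNgt; apply: contra nbom => /efar fi.
  by rewrite /bad; apply/orP; left; apply/existsP; exists i; rewrite mul1r.
apply: le_trans (sum_sqr_error (e := fun i => est i - x i) V0 k0 kn rows0 w0 efar nbom) _.
(* The squared errors sum to at most 4 k t1 V / rows, where V = t^2 / (c' k) and 4 t1 <= c'. *)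
have -> : w / L.+1%:R = t1 by rewrite /w mulfK ?gt_eqF //; lra.
rewrite [leRHS]mulrC ler_wpM2r ?invr_ge0 // /V DE mulrA ler_pdivrMr ?mulr_gt0 //.
  have -> : 4 * k%:R * t1 * t ^+ 2 = t ^+ 2 * (4 * t1 * k%:R) by ring.
  by apply: ler_wpM2l; rewrite ?sqr_ge0 // ler_wpM2r //; lra.
by lra.
Qed.
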